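(* Let $k$ be a field and let $\{\beta_i\}_{i\ge0}$, $\{\bar\gamma_i\}_{i>0}$ be sequences of positive rational numbers, with associated numbers $q_i,\bar s_i,\bar m_i,\bar r_{i,0}$ as in the context, such that $\beta_{i+1}>q_i\beta_i$ and $\bar\gamma_{i+1}>\bar r_{i,0}\beta_0+\bar s_i\bar\gamma_i$ for all $i>0$. Let $\{\lambda_i\}_{i>0}$, $\{\bar\mu_i\}_{i>0}$ be sequences in $k\setminus\{0\}$, and let $\{P_i\}_{i\ge0}$, $\{Q_i\}_{i>0}\subset k[x,y,z]$ be the defining polynomials determined by these data. Assume that infinitely many $q_i$ and infinitely many $\bar s_i$ are greater than $1$. Then there exists a unique valuation $\nu:k(x,y,z)\to\mathbb{Q}$ such that $\nu$ dominates $k[x,y,z]_{(x,y,z)}$ and $\nu(P_i)=\beta_i$ for all $i\ge 0$ and $\nu(Q_i)=\bar\gamma_i$ for all $i>0$.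
   Context: A valuation dominates a local ring $(R,m_R)$ of its field if its valuation ring $(V,m_V)$ satisfies $R\subset V$ and $m_V\cap R=m_R$. Numerical data. Given sequences of positive rationals $\{\beta_i\}_{i\ge0}$, $\{\bar\gamma_i\}_{i>0}$ set $\bar m_0=0$, $G_i=\sum_{j=0}^i\beta_j\mathbb{Z}$, $G=\bigcup_iG_i$, $\bar H_0=\{0\}$, $\bar H_i=\sum_{j=1}^i\bar\gamma_j\mathbb{Z}$, and for $i>0$: $q_i=\min\{q\in\mathbb{Z}_{>0}\mid q\beta_i\in G_{i-1}\}$, $\bar s_i=\min\{s\in\mathbb{Z}_{>0}\mid s\bar\gamma_i\in\bar H_{i-1}+G\}$, $\bar m_i=\max(\bar m_{i-1},\min\{j\in\mathbb{Z}_{\ge0}\mid\bar s_i\bar\gamma_i\in\bar H_{i-1}+G_j\})$. For each $i>0$ there are unique integers $n_{i,0}\in\mathbb{Z}$ and $n_{i,1},\dots,n_{i,i-1}\in\mathbb{Z}_{\ge0}$ with $n_{i,j}<q_j$ for $j>0$ and $q_i\beta_i=\sum_{j=0}^{i-1}n_{i,j}\beta_j$; and unique integers $a_i\in\mathbb{Z}$, $\bar n_{i,1},\dots,\bar n_{i,\bar m_i},\bar l_{i,1},\dots,\bar l_{i,i-1}\in\mathbb{Z}_{\ge0}$ with $\bar n_{i,j}<q_j$, $\bar l_{i,j}<\bar s_j$ and $\bar s_i\bar\gamma_i=a_i\beta_0+\sum_{j=1}^{\bar m_i}\bar n_{i,j}\beta_j+\sum_{j=1}^{i-1}\bar l_{i,j}\bar\gamma_j$.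 Set $\bar n_{i,0}=\max(0,a_i)$ and $\bar r_{i,0}=\max(0,-a_i)$. (Under the condition $\beta_{i+1}>q_i\beta_i$ for all $i>0$ one has $n_{i,0}>0$.) Defining polynomials: $P_0=x$, $P_1=y$, $Q_1=z$ and, for $i>0$, $$P_{i+1}=P_i^{q_i}-\lambda_i\prod_{j=0}^{i-1}P_j^{n_{i,j}},\qquad Q_{i+1}=x^{\bar r_{i,0}}Q_i^{\bar s_i}-\bar\mu_i\prod_{j=0}^{\bar m_i}P_j^{\bar n_{i,j}}\prod_{j=1}^{i-1}Q_j^{\bar l_{i,j}}.$$ *)

(* Defs.v *)
From HB Require Import structures.
From mathcomp Require Import all_boot all_order all_algebra.
From mathcomp Require Import fraction.
From mathcomp Require Export mpoly.
From Stdlib Require Import ClassicalEpsilon.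

Set Implicit Arguments.
Unset Strict Implicit.
Unset Printing Implicit Defensive.

Import Order.TTheory GRing.Theory Num.Theory.
Local Open Scope ring_scope.

Definition is_least (P : nat -> Prop) (n : nat) : Prop :=
  P n /\ forall m, P m -> (n <= m)%N.

(* Unspecified when no natural number satisfies P. *)
Definition least (P : nat -> Prop) : nat := epsilon (inhabits 0%N) (is_least P).

Section NumericalData.

(* The paper's sequence gamma-bar is indexed by i > 0: gam 0 is never used. *)
Variables beta gam : nat -> rat.

Definition grpG (i : nat) (r : rat) : Prop :=
  inIntSpan [tuple beta j | j < i.+1] r.

Definition grpGoo (r : rat) : Prop := exists i, grpG i r.

Definition grpH (i : nat) (r : rat) : Prop :=
  inIntSpan [tuple gam j.+1 | j < i] r.

Definition addgrp (A B : rat -> Prop) (r : rat) : Prop :=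
  exists a b, [/\ A a, B b & r = a + b].

(* In the definitions below, indexed by i > 0 in the paper, the value at
   i = 0 is never used, except for mbar 0 = 0. *)
Definition q (i : nat) : nat :=
  least (fun d => (0 < d)%N /\ grpG i.-1 (d%:R * beta i)).

Definition sbar (i : nat) : nat :=
  least (fun d => (0 < d)%N /\ addgrp (grpH i.-1) grpGoo (d%:R * gam i)).

Fixpoint mbar (i : nat) : nat :=
  if i is i'.+1 then
    maxn (mbar i')
      (least (fun j => addgrp (grpH i') (grpG j) ((sbar i)%:R * gam i)))
  else 0%N.

Definition is_expP (i : nat) (n : nat -> int) : Prop :=
  (forall j, (0 < j < i)%N -> 0 <= n j < (q j)%:Z) /\
  (q i)%:R * beta i = \sum_(0 <= j < i) (n j)%:~R * beta j.

(* The integers n_{i,j}; only the values at 0 <= j < i are relevant. *)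
Definition expP (i : nat) : nat -> int :=
  epsilon (inhabits (fun=> 0)) (is_expP i).

(* c = (a_i, j |-> nbar_{i,j}, j |-> lbar_{i,j}) *)
Definition is_expQ (i : nat) (c : int * (nat -> nat) * (nat -> nat)) : Prop :=
  let: (a, n, l) := c in
  [/\ forall j, (0 < j <= mbar i)%N -> (n j < q j)%N,
      forall j, (0 < j < i)%N -> (l j < sbar j)%N &
      (sbar i)%:R * gam i
        = a%:~R * beta 0%N + \sum_(1 <= j < (mbar i).+1) (n j)%:R * beta j
          + \sum_(1 <= j < i) (l j)%:R * gam j].

Definition expQ (i : nat) : int * (nat -> nat) * (nat -> nat) :=
  epsilon (inhabits (0, fun=> 0%N, fun=> 0%N)) (is_expQ i).

Definition acoef (i : nat) : int := (expQ i).1.1.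

Definition nbar (i j : nat) : nat :=
  if j == 0%N then `|Num.max 0%R (acoef i)|%N else (expQ i).1.2 j.

Definition rbar0 (i : nat) : nat := `|Num.max 0%R (- acoef i)%R|%N.

Definition lbar (i j : nat) : nat := (expQ i).2 j.

End NumericalData.

Section DefiningPolynomials.

Variables (k : fieldType) (beta gam : nat -> rat) (lam mu : nat -> k).

Definition varx : {mpoly k[3]} := 'X_(inord 0).
Definition vary : {mpoly k[3]} := 'X_(inord 1).
Definition varz : {mpoly k[3]} := 'X_(inord 2).

(* The exponent n_{i,j} is nonnegative for j > 0 by definition, and n_{i,0} > 0
   as soon as beta_{i+1} > q_i beta_i for all i > 0, so the absolute value only
   coerces it to nat. *)
Definition nextP (P : nat -> {mpoly k[3]}) (i : nat) : {mpoly k[3]} :=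
  P i ^+ q beta i - lam i *: \prod_(0 <= j < i) P j ^+ `|expP beta i j|%N.

(* seqP n lists P_0, ..., P_(n+1). *)
Fixpoint seqP (n : nat) : seq {mpoly k[3]} :=
  if n is n'.+1 then rcons (seqP n') (nextP (nth 0 (seqP n')) n)
  else [:: varx; vary].

Definition defP (i : nat) : {mpoly k[3]} := nth 0 (seqP i) i.

Definition nextQ (Q : nat -> {mpoly k[3]}) (i : nat) : {mpoly k[3]} :=
  varx ^+ rbar0 beta gam i * Q i ^+ sbar beta gam i
  - mu i *: (\prod_(0 <= j < (mbar beta gam i).+1) defP j ^+ nbar beta gam i j
             * \prod_(1 <= j < i) Q j ^+ lbar beta gam i j).

(* seqQ n lists Q_0, ..., Q_(n+1), with the unused entry Q_0 set to 0. *)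
Fixpoint seqQ (n : nat) : seq {mpoly k[3]} :=
  if n is n'.+1 then rcons (seqQ n') (nextQ (nth 0 (seqQ n')) n)
  else [:: 0; varz].

Definition defQ (i : nat) : {mpoly k[3]} := nth 0 (seqQ i) i.

Lemma size_seqP n : size (seqP n) = n.+2.
Proof. by elim: n => //= n IH; rewrite size_rcons IH. Qed.

Lemma size_seqQ n : size (seqQ n) = n.+2.
Proof. by elim: n => //= n IH; rewrite size_rcons IH. Qed.

Lemma nth_seqP n j : (j <= n.+1)%N -> nth 0 (seqP n) j = defP j.
Proof.
rewrite /defP; elim: n => [|n IH]; first by case: j => [|[|]].
rewrite leq_eqVlt => /orP[/eqP->|lt_j]; last first.
  by rewrite [LHS]/= nth_rcons size_seqP lt_j IH.
by rewrite [in RHS]/= !nth_rcons !size_rcons size_seqP ltnSn.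
Qed.

Lemma nth_seqQ n j : (j <= n.+1)%N -> nth 0 (seqQ n) j = defQ j.
Proof.
rewrite /defQ; elim: n => [|n IH]; first by case: j => [|[|]].
rewrite leq_eqVlt => /orP[/eqP->|lt_j]; last first.
  by rewrite [LHS]/= nth_rcons size_seqQ lt_j IH.
by rewrite [in RHS]/= !nth_rcons !size_rcons size_seqQ ltnSn.
Qed.

Lemma defP0 : defP 0 = varx. Proof. by []. Qed.
Lemma defP1 : defP 1 = vary. Proof. by rewrite -(@nth_seqP 0). Qed.
Lemma defQ1 : defQ 1 = varz. Proof. by rewrite -(@nth_seqQ 0). Qed.

Lemma defPS i : (0 < i)%N ->
  defP i.+1 = defP i ^+ q beta i
    - lam i *: \prod_(0 <= j < i) defP j ^+ `|expP beta i j|%N.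
Proof.
case: i => // n _; rewrite -(@nth_seqP n.+1) // [LHS]/= nth_rcons size_seqP.
rewrite ltnn eqxx /nextP nth_seqP //; congr (_ - _ *: _).
by apply: eq_big_nat => j /andP[_ lt_j]; rewrite nth_seqP // ltnW // ltnS ltnW.
Qed.

Lemma defQS i : (0 < i)%N ->
  defQ i.+1 = varx ^+ rbar0 beta gam i * defQ i ^+ sbar beta gam i
    - mu i *: (\prod_(0 <= j < (mbar beta gam i).+1) defP j ^+ nbar beta gam i j
               * \prod_(1 <= j < i) defQ j ^+ lbar beta gam i j).
Proof.
case: i => // n _; rewrite -(@nth_seqQ n.+1) // [LHS]/= nth_rcons size_seqQ.
rewrite ltnn eqxx /nextQ nth_seqQ //; congr (_ - _ *: (_ * _)).
by apply: eq_big_nat => j /andP[_ lt_j]; rewrite nth_seqQ // ltnW // ltnS ltnW.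
Qed.

End DefiningPolynomials.

Section Valuations.

Variable K : fieldType.

(* The value of nu at 0 is irrelevant. *)
Definition is_valuation (nu : K -> rat) : Prop :=
  (forall a b, a != 0 -> b != 0 -> nu (a * b) = nu a + nu b) /\
  (forall a b, a != 0 -> b != 0 -> a + b != 0 ->
     Num.min (nu a) (nu b) <= nu (a + b)).

Definition valuation_ring (nu : K -> rat) (a : K) : Prop :=
  a = 0 \/ 0 <= nu a.

(* The nonunits of the subring R, i.e. its maximal ideal when R is local. *)
Definition nonunits (R : K -> Prop) (a : K) : Prop :=
  R a /\ ~ exists b, R b /\ a * b = 1.

Definition dominates (nu : K -> rat) (R : K -> Prop) : Prop :=
  let V := valuation_ring nu in
  (forall a, R a -> V a) /\
  (forall a, nonunits V a /\ R a <-> nonunits R a).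

End Valuations.

Section LocalRing.

Variable k : fieldType.

Definition ratfun3 : fieldType := {fraction {mpoly k[3]}}.

Definition tofrac3 (f : {mpoly k[3]}) : ratfun3 := tofrac f.

Definition ideal_xyz (f : {mpoly k[3]}) : Prop :=
  exists a b c, f = a * varx k + b * vary k + c * varz k.

Definition loc_xyz (a : ratfun3) : Prop :=
  exists f g, ~ ideal_xyz g /\ a = tofrac3 f / tofrac3 g.

End LocalRing.

(* Main.v *)
Require Import Defs.
From mathcomp Require Import all_boot all_order all_algebra.
From mathcomp Require Import fraction ring lra zify.
From Stdlib Require Import ClassicalEpsilon.

(** Call standard a monomial x^t P_1^{a_1} P_2^{a_2} ... Q_1^{b_1} Q_2^{b_2} ...
    with t an integer, 0 <= a_j < q_j and 0 <= b_j < s_j.  Write v for the value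
    t beta_0 + sum a_j beta_j + sum b_j gamma_j that the valuation has to give
    it.  Everything follows from three facts.

    - The standard monomials have pairwise distinct values ([towerv_inj], used
      twice): q_j is the order of beta_j modulo the group generated by the
      previous beta's, and s_j is the order of gamma_j modulo the group
      generated by all beta's and the previous gamma's, so the top digit in
      which two digit sequences differ can be read off modulo that group.

    - The standard monomials are linearly independent over k
      ([mpoly_independent], [E2_independent]).  P_{j+1} has degree
      q_1 ... q_j in y and Q_{j+1} has degree s_1 ... s_j in z, so the degree
      of a standard monomial is a number written in mixed radix; distinct digit
      sequences give distinct degrees.  Since infinitely many q_j and s_j exceed
      1, every natural number has such an expansion ([radix_unbounded]).

    - Every product of powers of x, the P_j and the Q_j is a nonzero constant
      times the standard monomial of the same value, plus a combination of
      standard monomials of larger value ([straighten]): the recursions defining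
      P_{j+1} and Q_{j+1} rewrite P_j^{q_j} and Q_j^{s_j} in this way, because
      beta_{j+1} > q_j beta_j and gamma_{j+1} > r_j beta_0 + s_j gamma_j.

    By the third fact k[x,y,z] lies in the span of the standard monomials, and a valuation
    that is trivial on k and takes the value v on standard monomials must send a
    combination of them to the least value that occurs, as no two values
    coincide: this is uniqueness ([valuation_unique]).  Conversely the least
    value is well defined by linear independence, and it is multiplicative
    because the product of two leading terms again has a leading term of the
    summed value: this is existence ([nu_of_valuation]).  Domination holds as x,
    y and z get positive values ([nu_dominates]).

    The P_j over k[x, 1/x] and the Q_j over the span of the x^t and the P_j are
    handled by one construction, the tower over a family of valued elements. *)

Set Implicit Arguments.
Unset Strict Implicit.
Unset Printing Implicit Defensive.
Import Order.TTheory GRing.Theory Num.Theory.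
Local Open Scope ring_scope.

(** * Valuations with rational values *)

Section ValuationRing.

Variables (K : fieldType) (nu : K -> rat).
Hypothesis nu_val : is_valuation nu.
Local Notation V := (valuation_ring nu).

(** The maximal ideal of the valuation ring; 0 is listed apart because the value
    at 0 carries no information. *)
Definition val_pos (a : K) : Prop := a = 0 \/ 0 < nu a.

Lemma valuationM a b : a != 0 -> b != 0 -> nu (a * b) = nu a + nu b.
Proof. exact: nu_val.1. Qed.

Lemma valuation1 : nu 1 = 0.
Proof. by have := valuationM (oner_neq0 K) (oner_neq0 K); rewrite mulr1; lra. Qed.

Lemma valuationV a : a != 0 -> nu a^-1 = - nu a.
Proof.
move=> a0; have V0 : a^-1 != 0 by rewrite invr_neq0.
by have := valuationM a0 V0; rewrite divff // valuation1; lra.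
Qed.

Lemma valuationN a : a != 0 -> nu (- a) = nu a.
Proof.
have N0 : -1 != 0 :> K by rewrite oppr_eq0 oner_neq0.
move=> a0; rewrite -mulN1r valuationM //.
by have := valuationM N0 N0; rewrite mulrNN mulr1 valuation1; lra.
Qed.

Lemma valuation_dominant a h : a != 0 -> h = 0 \/ nu a < nu h ->
  a + h != 0 /\ nu (a + h) = nu a.
Proof.
move=> a0 [->|lt_h]; first by rewrite addr0.
case: (eqVneq h 0) => [->|h0]; first by rewrite addr0.
have ah0 : a + h != 0.
  rewrite addr_eq0; apply/eqP => ah; move: lt_h.
  by rewrite ah valuationN // ltxx.
split=> //; apply/eqP; rewrite eq_le; apply/andP; split.
  rewrite leNgt; apply/negP => lt_a.
  have h'0 : - h != 0 by rewrite oppr_eq0.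
  have := nu_val.2 _ _ ah0 h'0; rewrite addrK valuationN // => /(_ a0).
  by rewrite leNgt lt_min lt_a lt_h.
by apply: le_trans (nu_val.2 _ _ a0 h0 ah0); rewrite le_min lexx ltW.
Qed.

Lemma valuationX a n : a != 0 -> nu (a ^+ n) = n%:R * nu a.
Proof.
move=> a0; elim: n => [|n IH]; first by rewrite valuation1 mul0r.
by rewrite exprS valuationM ?expf_neq0 // IH -natr1; ring.
Qed.

Lemma valuationXz a (t : int) : a != 0 -> nu (a ^ t) = t%:~R * nu a.
Proof.
move=> a0; case: t => n; first by rewrite -exprnP valuationX.
by rewrite NegzE -exprnN valuationV ?expf_neq0 // valuationX // mulrNz mulNr.
Qed.

Lemma valringD a b : V a -> V b -> V (a + b).
Proof.
move=> [->|a0]; first by rewrite add0r.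
move=> [->|b0]; first by rewrite addr0; right.
case: (eqVneq a 0) => [->|an0]; first by rewrite add0r; right.
case: (eqVneq b 0) => [->|bn0]; first by rewrite addr0; right.
case: (eqVneq (a + b) 0) => [|abn0]; first by left.
by right; apply: le_trans (nu_val.2 _ _ an0 bn0 abn0); rewrite le_min a0.
Qed.

Lemma val_posD a b : val_pos a -> val_pos b -> val_pos (a + b).
Proof.
move=> [->|a0]; first by rewrite add0r.
move=> [->|b0]; first by rewrite addr0; right.
case: (eqVneq a 0) => [->|an0]; first by rewrite add0r; right.
case: (eqVneq b 0) => [->|bn0]; first by rewrite addr0; right.
case: (eqVneq (a + b) 0) => [|abn0]; first by left.
by right; apply: lt_le_trans (nu_val.2 _ _ an0 bn0 abn0); rewrite lt_min a0.
Qed.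

Lemma valringM a b : V a -> V b -> V (a * b).
Proof.
move=> [->|a0]; first by rewrite mul0r; left.
move=> [->|b0]; first by rewrite mulr0; left.
case: (eqVneq a 0) => [->|an0]; first by rewrite mul0r; left.
case: (eqVneq b 0) => [->|bn0]; first by rewrite mulr0; left.
by right; rewrite valuationM // addr_ge0.
Qed.

Lemma val_posM a b : V a -> val_pos b -> val_pos (a * b).
Proof.
move=> [->|a0]; first by rewrite mul0r; left.
move=> [->|b0]; first by rewrite mulr0; left.
case: (eqVneq a 0) => [->|an0]; first by rewrite mul0r; left.
case: (eqVneq b 0) => [->|bn0]; first by rewrite mulr0; left.
by right; rewrite valuationM // ltr_wpDl.
Qed.

Lemma valring_const (k : fieldType) (iota : {rmorphism k -> K}) :
  (forall c, c != 0 -> nu (iota c) = 0) -> forall c, V (iota c).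
Proof.
move=> nu_c c; case: (eqVneq c 0) => [->|c0]; first by left; rewrite rmorph0.
by right; rewrite nu_c.
Qed.

(** Elements outside the ideal m are units of the localization and have value 0,
    so a nonunit f / g of the localization has f in m, hence a positive value. *)
Lemma dominates_localization (R : pzRingType) (tau : R -> K) (m : R -> Prop) :
  (forall f, V (tau f)) -> (forall f, m f -> val_pos (tau f)) ->
  (forall f, ~ m f -> tau f != 0 /\ nu (tau f) = 0) ->
  dominates nu (fun a => exists f g, ~ m g /\ a = tau f / tau g).
Proof.
move=> Vtau pos_m unit_m; set loc := fun a => _.
have RV a : loc a -> V a.
  move=> [f [g [/unit_m[g0 vg] ->]]]; apply: valringM => //.
  by right; rewrite valuationV // vg oppr0.
split=> // a; split=> [[[Va Na] Ra]|[Ra Na]].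
  by split=> // -[b [Rb Eab]]; apply: Na; exists b; split=> //; apply: RV.
split=> //; split; first exact: RV.
move=> [b [Vb Eab]].
have nz : a * b != 0 by rewrite Eab oner_neq0.
have [a0 b0] : a != 0 /\ b != 0 by move: nz; rewrite mulf_eq0 negb_or => /andP[].
have nu_a : 0 < nu a.
  case: Ra Na => f [g [Ng Ea]] Na.
  have If : m f.
    case: (excluded_middle_informative (m f)) => // Nf; case: Na.
    have [f0 _] := unit_m f Nf; have [g0 _] := unit_m g Ng.
    exists (tau g / tau f); split; last by rewrite Ea mulrA divfK // divff.
    by exists g, f.
  have [g0 vg] := unit_m g Ng.
  have Ef : tau f = a * tau g by rewrite Ea divfK.
  case: (pos_m f If) => [f0|]; last by rewrite Ef valuationM // vg addr0.
  by move/eqP: Ef; rewrite f0 eq_sym mulf_eq0 (negPf a0) (negPf g0).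
case: Vb => [/eqP|]; first by rewrite (negPf b0).
by move=> nu_b; have := valuationM a0 b0; rewrite Eab valuation1; lra.
Qed.

(** A nonzero constant and its inverse both have nonnegative value. *)
Lemma dominates_const (k : fieldType) (iota : {rmorphism k -> K}) (R : K -> Prop) :
  dominates nu R -> (forall c, R (iota c)) -> forall c, c != 0 -> nu (iota c) = 0.
Proof.
move=> [RV _] Rc c c0.
have nu_ge0 d : d != 0 -> 0 <= nu (iota d).
  move=> d0; case: (RV _ (Rc d)) => // /eqP.
  by rewrite fmorph_eq0 (negPf d0).
apply/eqP; rewrite eq_le nu_ge0 // andbT -oppr_ge0 -valuationV ?fmorph_eq0 //.
by rewrite -fmorphV nu_ge0 // invr_neq0.
Qed.

End ValuationRing.

(** * Leading terms with respect to a family of valued elements *)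

Section ValuedFamily.

Variables (k K : fieldType) (iota : {rmorphism k -> K}).
Variables (I : eqType) (E : I -> K) (v : I -> rat).

Definition comb (s : seq (k * I)) : K := \sum_(p <- s) iota p.1 * E p.2.

(** The elements [above u] and those with [has_value u] play the role of the
    elements of value > u and = u.  They are described by the existence of an
    expansion, so that they can be computed with before E is known to be linearly
    independent. *)
Definition above (u : rat) (f : K) : Prop :=
  exists2 s, {in s, forall p, u < v p.2} & f = comb s.

Definition has_value (u : rat) (f : K) : Prop :=
  exists c i, [/\ c != 0, v i = u & above u (f - iota c * E i)].

Lemma above0 u : above u 0.
Proof. by exists [::]; rewrite /comb ?big_nil. Qed.

Lemma aboveD u f g : above u f -> above u g -> above u (f + g).
Proof.
move=> [s Hs ->] [t Ht ->]; exists (s ++ t); last by rewrite /comb big_cat.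
by move=> p; rewrite mem_cat => /orP[/Hs|/Ht].
Qed.

Lemma aboveZ u c f : above u f -> above u (iota c * f).
Proof.
move=> [s Hs ->]; exists [seq (c * p.1, p.2) | p <- s].
  by move=> p /mapP[p' /Hs ? ->].
rewrite /comb big_map mulr_sumr; apply: eq_bigr => p _ /=.
by rewrite rmorphM mulrA.
Qed.

Lemma aboveB u f g : above u f -> above u g -> above u (f - g).
Proof.
move=> Hf Hg; apply: aboveD => //; rewrite -mulN1r -(rmorph1 iota) -rmorphN.
exact: aboveZ.
Qed.

Lemma above_le u u' f : u' <= u -> above u f -> above u' f.
Proof. by move=> le_u [s Hs ->]; exists s => // p /Hs; apply: le_lt_trans. Qed.

Lemma above_comb u (T : eqType) (s : seq (k * T)) (F : T -> K) :
  {in s, forall p, above u (F p.2)} -> above u (\sum_(p <- s) iota p.1 * F p.2).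
Proof.
move=> Hs; rewrite big_seq; elim/big_rec: _ => [|p f ps Hf]; first exact: above0.
by apply: aboveD => //; apply/aboveZ/Hs.
Qed.

Lemma above_E u i : u < v i -> above u (E i).
Proof.
move=> lt_u; exists [:: (1, i)]; last by rewrite /comb big_seq1 rmorph1 mul1r.
by move=> p; rewrite inE => /eqP->.
Qed.

Lemma valueE i : has_value (v i) (E i).
Proof.
by exists 1, i; rewrite oner_neq0 rmorph1 mul1r subrr; split=> //; apply: above0.
Qed.

Lemma valueZ u c f : c != 0 -> has_value u f -> has_value u (iota c * f).
Proof.
move=> c0 [d [i [d0 <- Hf]]]; exists (c * d), i; split; rewrite ?mulf_neq0 //.
by rewrite rmorphM -mulrA -mulrBr; apply: aboveZ.
Qed.

Lemma valueD u f h : has_value u f -> above u h -> has_value u (f + h).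
Proof.
move=> [d [i [d0 <- Hf]]] Hh; exists d, i; split=> //.
by rewrite addrAC; apply: aboveD.
Qed.

Lemma value_above u u' f : u' < u -> has_value u f -> above u' f.
Proof.
move=> lt_u [d [i [d0 vi Hf]]]; rewrite -(subrK (iota d * E i) f).
apply: aboveD; first exact: above_le (ltW lt_u) Hf.
by apply/aboveZ/above_E; rewrite vi.
Qed.

Section Multiplicative.

Hypothesis valueEM : forall i j, has_value (v i + v j) (E i * E j).

Lemma aboveM u w f g : above u f -> above w g -> above (u + w) (f * g).
Proof.
move=> [s Hs ->] [t Ht ->]; rewrite /comb mulr_suml.
under eq_bigr do rewrite -mulrA.
apply: (above_comb (F := fun i => E i * _)) => p /Hs lt_u; rewrite mulr_sumr.
under eq_bigr do rewrite mulrCA.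
apply: (above_comb (F := fun i => _ * E i)) => p' /Ht lt_w.
by apply: value_above (valueEM _ _); apply: ltrD.
Qed.

Lemma above_valueM u w f g : above u f -> has_value w g -> above (u + w) (f * g).
Proof.
move=> Hf [d [i [d0 vi Hg]]]; rewrite -(subrK (iota d * E i) g) mulrDr.
apply: aboveD; first exact: aboveM.
case: Hf => s Hs ->; rewrite mulrCA; apply: aboveZ; rewrite /comb mulr_suml.
under eq_bigr do rewrite -mulrA.
apply: (above_comb (F := fun i => E i * _)) => p /Hs lt_u.
by apply: value_above (valueEM _ _); rewrite vi ltrD2r.
Qed.

(** The product of the leading terms has a leading term by [valueEM], and the
    three other products only contribute larger values. *)
Lemma valueM u w f g :
  has_value u f -> has_value w g -> has_value (u + w) (f * g).
Proof.
move=> [c [i [c0 vi Hf]]] Hg; rewrite -(subrK (iota c * E i) f) mulrDl.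
rewrite [X in has_value _ X]addrC.
apply: valueD; last exact: above_valueM.
rewrite -mulrA; apply: valueZ => //; case: Hg => d [j [d0 vj Hg]].
rewrite -(subrK (iota d * E j) g) mulrDr [X in has_value _ X]addrC mulrCA; apply: valueD.
  by apply: valueZ => //; rewrite -vi -vj.
by rewrite [E i * _]mulrC [u + w]addrC -vi; apply: above_valueM (valueE i).
Qed.

Lemma valueX u f n : has_value 0 1 -> has_value u f ->
  has_value (n%:R * u) (f ^+ n).
Proof.
move=> H1 Hf; elim: n => [|n IH]; first by rewrite mul0r.
by rewrite exprS -natr1 mulrDl mul1r addrC; apply: valueM.
Qed.

Lemma value_prod (T : Type) (r : seq T) (P : pred T) (u : T -> rat) (f : T -> K) :
  has_value 0 1 -> (forall j, P j -> has_value (u j) (f j)) ->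
  has_value (\sum_(j <- r | P j) u j) (\prod_(j <- r | P j) f j).
Proof.
move=> H1 Hf; elim/big_rec2: _ => // j w g Pj Hg.
by apply: valueM => //; apply: Hf.
Qed.

End Multiplicative.

End ValuedFamily.

(** * Mixed radix expansions *)

Section MixedRadix.

Local Open Scope nat_scope.

Variable s : nat -> nat.
Hypothesis s_gt0 : forall j, (0 < s j)%N.

Definition radix (j : nat) : nat := \prod_(l < j) s l.
Definition digit (j m : nat) : nat := (m %/ radix j) %% s j.

Lemma radixS j : radix j.+1 = (radix j * s j)%N.
Proof. by rewrite /radix big_ord_recr. Qed.

Lemma radix_gt0 j : (0 < radix j)%N.
Proof. by rewrite /radix prodn_gt0. Qed.

Lemma leq_radix i j : (i <= j)%N -> (radix i <= radix j)%N.
Proof.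
move=> /subnK <-; elim: (j - i)%N => // n IH.
by rewrite addSn radixS (leq_trans IH) // leq_pmulr.
Qed.

Lemma ltn_digit j m : (digit j m < s j)%N.
Proof. exact: ltn_pmod. Qed.

Lemma digit_small j m : (m < radix j)%N -> digit j m = 0%N.
Proof. by move=> lt_m; rewrite /digit divn_small // mod0n. Qed.

Lemma sum_digit J m : (\sum_(j < J) digit j m * radix j)%N = (m %% radix J)%N.
Proof.
elim: J => [|J IH]; first by rewrite big_ord0 /radix big_ord0 modn1.
rewrite big_ord_recr /= {}IH radixS /digit [RHS](divn_eq _ (radix J)).
rewrite [(radix J * s J)%N]mulnC modn_dvdm ?dvdn_mull // addnC -modn_divl.
by rewrite mulnC.
Qed.

Lemma sum_digit_small J m : (m < radix J)%N ->
  (\sum_(j < J) digit j m * radix j)%N = m.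
Proof. by move=> lt_m; rewrite sum_digit modn_small. Qed.

Lemma ltn_sum_digits J (b : nat -> nat) :
  (forall j, (j < J)%N -> (b j < s j)%N) ->
  (\sum_(j < J) b j * radix j < radix J)%N.
Proof.
elim: J => [|J IH] Hb; first by rewrite big_ord0 /radix big_ord0.
rewrite big_ord_recr /= radixS.
have lt_b := Hb J (ltnSn J); have := IH (fun j lt_j => Hb j (ltnW lt_j)).
move: (\sum_(j < J) _)%N => S lt_S.
have : (b J).+1 * radix J <= s J * radix J by rewrite leq_mul2r lt_b orbT.
by lia.
Qed.

(** For l >= j + 1 the weight of the l-th digit is a multiple of s_j times the weight
    of the j-th, so only the digits up to j matter; those below j sum to less than
    the weight of the j-th. *)
Lemma digit_sum J (b : nat -> nat) j :
  (forall j, (j < J)%N -> (b j < s j)%N) -> (j < J)%N ->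
  digit j (\sum_(j < J) b j * radix j) = b j.
Proof.
elim: J => // J IH Hb; rewrite ltnS leq_eqVlt big_ord_recr /=.
have Hb' l : (l < J)%N -> (b l < s l)%N by move=> lt_l; apply/Hb/ltnW.
case/orP=> [/eqP->|lt_j].
  rewrite /digit addnC divnMDl ?radix_gt0 // divn_small ?ltn_sum_digits //.
  by rewrite addn0 modn_small // Hb.
rewrite -[RHS]IH // /digit.
have /dvdnP[c ->] : (s j * radix j %| radix J)%N.
  rewrite mulnC -radixS -(subnK lt_j) addnC.
  by elim: (J - j.+1)%N => [|n]; rewrite ?addn0 // addnS (radixS (_ + n)); apply: dvdn_mulr.
by rewrite !mulnA addnC divnMDl ?radix_gt0 // modnMDl.
Qed.

End MixedRadix.

(** * Towers over a family of valued elements *)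

Section Exponents.

Definition lin (R : pzSemiRingType) J (g : nat -> R) (b : nat -> nat) : R :=
  \sum_(j < J) (b j)%:R * g j.

Definition mon (R : comNzRingType) J (Q : nat -> R) (b : nat -> nat) : R :=
  \prod_(j < J) Q j ^+ b j.

Definition delta (j a l : nat) : nat := if l == j then a else 0%N.

Definition prefix_of (j : nat) (b : nat -> nat) (l : nat) : nat :=
  if (l < j)%N then b l else 0%N.

Section Lin.
Variables (R : pzSemiRingType) (J : nat) (g : nat -> R).

Lemma eq_lin b c : (forall j, (j < J)%N -> b j = c j) -> lin J g b = lin J g c.
Proof. by move=> bc; apply: eq_bigr => j _; rewrite bc. Qed.

Lemma linD b c : lin J g (fun l => b l + c l)%N = lin J g b + lin J g c.
Proof. by rewrite -big_split; apply: eq_bigr => j _; rewrite natrD mulrDl. Qed.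

Lemma lin_delta j a : (j < J)%N -> lin J g (delta j a) = a%:R * g j.
Proof.
move=> lt_j; rewrite /lin (bigD1 (Ordinal lt_j)) //= /delta eqxx big1 ?addr0 //.
by move=> l /negPf; rewrite -val_eqE /= => ->; rewrite mul0r.
Qed.

Lemma lin_prefix j b : (j <= J)%N -> lin J g (prefix_of j b) = lin j g b.
Proof.
move=> le_j; rewrite /lin (big_ord_widen _ (fun l => (b l)%:R * g l) le_j).
rewrite [RHS]big_mkcond; apply: eq_bigr => l _; rewrite /prefix_of.
by case: ifP; rewrite ?mul0r.
Qed.

End Lin.

Section Mon.
Variables (R : comNzRingType) (J : nat) (Q : nat -> R).

Lemma eq_mon b c : (forall j, (j < J)%N -> b j = c j) -> mon J Q b = mon J Q c.
Proof. by move=> bc; apply: eq_bigr => j _; rewrite bc. Qed.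

Lemma monD b c : mon J Q (fun l => b l + c l)%N = mon J Q b * mon J Q c.
Proof. by rewrite -big_split; apply: eq_bigr => j _; rewrite exprD. Qed.

Lemma mon_delta j a : (j < J)%N -> mon J Q (delta j a) = Q j ^+ a.
Proof.
move=> lt_j; rewrite /mon (bigD1 (Ordinal lt_j)) //= /delta eqxx big1 ?mulr1 //.
by move=> l /negPf; rewrite -val_eqE /= => ->.
Qed.

Lemma mon_prefix j b : (j <= J)%N -> mon J Q (prefix_of j b) = mon j Q b.
Proof.
move=> le_j; rewrite /mon (big_ord_widen _ (fun l => Q l ^+ b l) le_j).
rewrite [RHS]big_mkcond; apply: eq_bigr => l _; rewrite /prefix_of.
by case: ifP.
Qed.

End Mon.

Lemma lin_nat J (f b : nat -> nat) : lin J f b = (\sum_(j < J) (b j * f j))%N.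
Proof.
rewrite -[LHS]/(\big[addn/0%N]_(j < J) ((b j)%:R * f j)).
by apply: eq_bigr => j _; rewrite natn.
Qed.

Section Standard.

Variables (s len : nat -> nat).
Hypothesis s_gt0 : forall j, (0 < s j)%N.
Hypothesis ltn_len : forall m, (m < radix s (len m))%N.

(** [len m] is any bound beyond which the digits of m vanish; it exists as soon as
    the radix is unbounded, although digits of radix 1 may come in long runs. *)
Definition stdmon (R : comNzRingType) (Q : nat -> R) (m : nat) : R :=
  mon (len m) Q (digit s ^~ m).

Definition stdlin (R : pzSemiRingType) (g : nat -> R) (m : nat) : R :=
  lin (len m) g (digit s ^~ m).

(** Past the length of m all digits are 0, so that the bound does not matter. *)
Lemma big_digit (R : Type) (idx : R) (op : Monoid.law idx) (F : nat -> nat -> R)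
    J J' m :
  (forall j, F 0%N j = idx) -> (m < radix s J)%N -> (m < radix s J')%N ->
  \big[op/idx]_(j < J) F (digit s j m) j = \big[op/idx]_(j < J') F (digit s j m) j.
Proof.
move=> F0; wlog le_J : J J' / (J <= J')%N.
  by move=> H; case: (leqP J J') => [|/ltnW] le_J ltJ ltJ'; [|symmetry]; apply: H.
move=> lt_m _; rewrite -!(big_mkord xpredT (fun j => F (digit s j m) j)).
rewrite [RHS](big_cat_nat (n := J)) //= [X in _ = op _ X]big_nat.
rewrite [X in _ = op _ X]big1 ?Monoid.mulm1 //.
move=> j /andP[le_j _]; rewrite digit_small ?F0 //.
exact: leq_trans lt_m (leq_radix _ le_j).
Qed.

Section Digits.
Variables (J : nat) (b : nat -> nat).
Hypothesis ltn_b : forall j, (j < J)%N -> (b j < s j)%N.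

Lemma stdmonE (R : comNzRingType) (Q : nat -> R) :
  mon J Q b = stdmon Q (lin J (radix s) b).
Proof.
have lt_m := ltn_sum_digits ltn_b; rewrite lin_nat.
rewrite /stdmon/mon -(big_digit _ (F := fun a j => Q j ^+ a) _ lt_m (ltn_len _)) //.
by apply: eq_bigr => j _; rewrite digit_sum.
Qed.

Lemma stdlinE (R : pzSemiRingType) (g : nat -> R) :
  lin J g b = stdlin g (lin J (radix s) b).
Proof.
have lt_m := ltn_sum_digits ltn_b; rewrite lin_nat.
rewrite /stdlin /lin.
rewrite -(big_digit _ (F := fun a j => a%:R * g j) _ lt_m (ltn_len _)).
  by apply: eq_bigr => j _; rewrite digit_sum.
by move=> j; rewrite mul0r.
Qed.

End Digits.

Lemma stdmon_len (R : comNzRingType) (Q : nat -> R) J m :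
  (m < radix s J)%N -> stdmon Q m = mon J Q (digit s ^~ m).
Proof.
by move=> lt_m; apply: (big_digit _ (F := fun a j => Q j ^+ a)).
Qed.

Lemma stdlin_len (R : pzSemiRingType) (g : nat -> R) J m :
  (m < radix s J)%N -> stdlin g m = lin J g (digit s ^~ m).
Proof.
move=> lt_m; apply: (big_digit _ (F := fun a j => a%:R * g j)) => // j.
by rewrite mul0r.
Qed.

End Standard.
End Exponents.

Lemma valuation_mon (K : fieldType) (nu : K -> rat) J (Q : nat -> K) b :
  is_valuation nu -> (forall j, Q j != 0) ->
  nu (mon J Q b) = lin J (nu \o Q) b.
Proof.
move=> nu_val Q0; rewrite /mon /lin; elim: J => [|J IH].
  by rewrite !big_ord0 (valuation1 nu_val).
rewrite !big_ord_recr (valuationM nu_val) ?expf_neq0 //=.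
  by rewrite IH (valuationX nu_val).
by rewrite prodf_seq_neq0; apply/allP => j _ /=; rewrite expf_neq0.
Qed.

Section Tower.

Variables (k K : fieldType) (iota : {rmorphism k -> K}).
Variables (I : eqType) (E : I -> K) (v : I -> rat).
Local Notation base_value := (has_value iota E v).

Hypothesis valueEM : forall i j, base_value (v i + v j) (E i * E j).
Hypothesis value1 : base_value 0 1.

(** Up to terms of larger value, Q_j^{s_j} is a monomial in the earlier Q_l with
    standard exponents and with a coefficient U_j from the base; the deviation is a
    base multiple of Q_{j+1}. *)
Variables (Q U W : nat -> K) (g uu ww : nat -> rat) (s len : nat -> nat).
Variable n : nat -> nat -> nat.
Hypothesis s_gt0 : forall j, (0 < s j)%N.
Hypothesis ltn_len : forall m, (m < radix s (len m))%N.
Hypothesis ltn_n : forall j l, (l < j)%N -> (n j l < s l)%N.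
Hypothesis relQ : forall j, Q j ^+ s j = U j * mon j Q (n j) + W j * Q j.+1.
Hypothesis valueU : forall j, base_value (uu j) (U j).
Hypothesis relg : forall j, (s j)%:R * g j = uu j + lin j g (n j).
Hypothesis valueW : forall j, base_value (ww j) (W j).
Hypothesis ltg : forall j, (s j)%:R * g j < ww j + g j.+1.

Definition towerE (p : I * nat) : K := E p.1 * stdmon s len Q p.2.
Definition towerv (p : I * nat) : rat := v p.1 + stdlin s len g p.2.

Local Notation tower_value := (has_value iota towerE towerv).

(** If multiplying each member of the base family by M shifts its value by w, then
    so does multiplying any element that has a value. *)
Lemma value_scale u w f M : (forall i, tower_value (v i + w) (E i * M)) ->
  base_value u f -> tower_value (u + w) (f * M).
Proof.
move=> HM [c [i [c0 <- [t Ht Ef]]]]; rewrite -(subrK (iota c * E i) f) mulrDl.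
rewrite [X in tower_value _ X]addrC -mulrA; apply: valueD; first exact: valueZ.
rewrite Ef /comb mulr_suml; under eq_bigr do rewrite -mulrA.
apply: (above_comb (F := fun i => E i * M)) => p /Ht lt_p.
by apply: value_above (HM _); rewrite ltrD2r.
Qed.

(** Rewriting Q_j^{s_j} for some digit b_j >= s_j gives two monomials: one of the same
    value and smaller degree, and one of larger value where a block of s_j copies of
    Q_j has become a single Q_{j+1}.  The latter keeps the degree but decreases the
    sum of the b_l (J - l), which measures how far the exponents are from the top.
    Hence the nested induction. *)
Lemma straighten J b : (lin J (radix s) b < radix s J)%N ->
  forall i, tower_value (v i + lin J g b) (E i * mon J Q b).
Proof.
(* The sum of the b_l (J - l): it drops when exponents move towards the top. *)
pose wt b := lin J (subn J) b.
have [D] := ubnP (lin J (radix s) b); elim: D b => // D IHD b.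
have [w] := ubnP (wt b); elim: w b => // w IHw b lt_w lt_D lt_J i.
have [/forallP /= std|] := boolP [forall j : 'I_J, (b j < s j)%N].
  have ltb j : (j < J)%N -> (b j < s j)%N.
    by move=> lt_j; apply: (std (Ordinal lt_j)).
  rewrite (stdmonE s_gt0 ltn_len ltb) (stdlinE s_gt0 ltn_len ltb).
  exact: (valueE iota towerE towerv (i, _)).
rewrite negb_forall => /existsP[[j lt_j] /=]; rewrite -leqNgt => le_sj.
pose c l := (b l - delta j (s j) l)%N.
have bE l : (l < J)%N -> b l = (c l + delta j (s j) l)%N.
  by move=> _; rewrite /c /delta; case: eqP => [->|_]; rewrite ?subnK ?subn0 ?addn0.
have linb (R : pzSemiRingType) (f : nat -> R) : lin J f b = lin J f c + (s j)%:R * f j.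
  by rewrite (eq_lin f bE) linD lin_delta.
have degb : lin J (radix s) b = (lin J (radix s) c + radix s j.+1)%N.
  by rewrite linb natn radixS mulnC.
(* The bound on the degree keeps Q_{j+1} among the first J elements. *)
have lt_j1 : (j.+1 < J)%N.
  rewrite ltnNge; apply/negP => /(leq_radix s_gt0) le_J.
  by move: lt_J; rewrite ltnNge degb (leq_trans le_J) // leq_addl.
have monb : E i * mon J Q b =
    (E i * U j) * mon J Q (fun l => c l + prefix_of j (n j) l)%N
    + (E i * W j) * mon J Q (fun l => c l + delta j.+1 1 l)%N.
  rewrite (eq_mon Q bE) !monD !mon_delta // mon_prefix ?(ltnW lt_j) // relQ expr1.
  by ring.
have degn : (lin j (radix s) (n j) < radix s j)%N.
  by rewrite lin_nat; apply: ltn_sum_digits => // l; apply: ltn_n.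
have le_r : (radix s j <= radix s j.+1)%N by apply: leq_radix.
rewrite monb; apply: valueD.
  have -> : v i + lin J g b
      = v i + uu j + lin J g (fun l => c l + prefix_of j (n j) l)%N.
    by rewrite linb linD lin_prefix ?(ltnW lt_j) // relg; ring.
  apply: value_scale; last by apply: valueM => //; apply: valueE.
  by apply: IHD; rewrite linD lin_prefix ?(ltnW lt_j) // -[GRing.add _ _]/(addn _ _); lia.
have lt_v : v i + lin J g b
    < v i + ww j + lin J g (fun l => c l + delta j.+1 1 l)%N.
  by rewrite linb linD lin_delta // mul1r; have := ltg j; lra.
apply: value_above lt_v _; apply: value_scale; last first.
  by apply: valueM => //; apply: valueE.
have degE : lin J (radix s) (fun l => c l + delta j.+1 1 l)%N = lin J (radix s) b.
  by rewrite linD lin_delta // mul1r degb.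
apply: IHw; rewrite ?degE //; move: lt_w; rewrite /wt linb linD lin_delta //.
rewrite natn mul1r -![GRing.add _ _]/(addn _ _) -![GRing.mul _ _]/(muln _ _).
have := s_gt0 j; have := leq_pmull (J - j) (s_gt0 j); lia.
Qed.

Lemma tower_value_mon u f J b : (lin J (radix s) b < radix s J)%N ->
  base_value u f -> tower_value (u + lin J g b) (f * mon J Q b).
Proof. by move=> lt_J; apply: value_scale; apply: straighten. Qed.

Lemma tower_valueEM p p' : tower_value (towerv p + towerv p') (towerE p * towerE p').
Proof.
case: p p' => [i m] [i' m']; rewrite /towerv /towerE /=.
have lt_m : (m + m' < radix s (len (m + m')))%N by [].
have lt_m1 := leq_ltn_trans (leq_addr m' m) lt_m.
have lt_m2 := leq_ltn_trans (leq_addl m m') lt_m.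
rewrite !(stdmon_len s_gt0 ltn_len _ lt_m1) !(stdmon_len s_gt0 ltn_len _ lt_m2).
rewrite !(stdlin_len s_gt0 ltn_len _ lt_m1) !(stdlin_len s_gt0 ltn_len _ lt_m2).
rewrite addrACA mulrACA -linD -monD; apply: tower_value_mon => //.
by rewrite linD !lin_nat !sum_digit_small.
Qed.

Lemma tower_value_base u f : base_value u f -> tower_value u f.
Proof.
move=> Hf; have := @tower_value_mon u f 0 (fun=> 0%N).
by rewrite /lin /mon !big_ord0 addr0 mulr1 /radix big_ord0; apply.
Qed.

Lemma tower_valueQ j : tower_value (g j) (Q j).
Proof.
pose J := len (radix s j).
have lt_J : (radix s j < radix s J)%N by apply: ltn_len.
have lt_j : (j < J)%N.
  by rewrite ltnNge; apply/negP=> /(leq_radix s_gt0); rewrite leqNgt lt_J.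
have := @tower_value_mon 0 1 J (delta j 1).
by rewrite !lin_delta // mon_delta // add0r !mul1r; apply.
Qed.

Hypothesis v_inj : injective v.
Hypothesis s_min : forall j D i i' (h : nat -> int), (0 < D)%N ->
  D%:R * g j = v i - v i' + \sum_(l < j) (h l)%:~R * g l -> (s j <= D)%N.

(** If the top digits differed, their difference D, 0 < D < s_J, would satisfy
    D g_J = (an element of the group generated by the base values and the g_l, l < J),
    against the minimality of s_J. *)
Lemma digits_inj J (b b' : nat -> nat) i i' :
  (forall j, (b j < s j)%N) -> (forall j, (b' j < s j)%N) ->
  v i + lin J g b = v i' + lin J g b' ->
  i = i' /\ forall j, (j < J)%N -> b j = b' j.
Proof.
move=> ltb ltb'; elim: J => [|J IH]; rewrite /lin ?big_ord0 ?addr0.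
  by move/v_inj->.
rewrite !big_ord_recr /= -![\sum_(_ < _) _]/(lin J g _) => eq_v.
have bJ : b J = b' J.
  clear IH; wlog lt_b : b b' i i' ltb ltb' eq_v / (b' J < b J)%N.
    move=> H; case: (ltngtP (b J) (b' J)) => // lt_b; last exact: (H b b' i i').
    by symmetry; apply: (H b' b i' i).
  have: (s J <= b J - b' J)%N.
    apply: (@s_min J _ i' i (fun l => (b' l)%:Z - (b l)%:Z)); first by rewrite subn_gt0.
    rewrite natrB 1?ltnW // mulrBl.
    under eq_bigr do rewrite rmorphB /= mulrBl.
    by rewrite sumrB -/(lin J g b) -/(lin J g b'); lra.
  by rewrite leqNgt; have := ltb J; lia.
have [-> Hb] : i = i' /\ (forall j, (j < J)%N -> b j = b' j).
  by apply: IH; move: eq_v; rewrite bJ; lra.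
by split=> // j; rewrite ltnS leq_eqVlt => /orP[/eqP->|/Hb].
Qed.

Lemma towerv_inj : injective towerv.
Proof.
move=> [i m] [i' m']; rewrite /towerv /=.
have lt_m : (m + m' < radix s (len (m + m')))%N by [].
have lt_m1 := leq_ltn_trans (leq_addr m' m) lt_m.
have lt_m2 := leq_ltn_trans (leq_addl m m') lt_m.
rewrite !(stdlin_len s_gt0 ltn_len _ lt_m1) !(stdlin_len s_gt0 ltn_len _ lt_m2).
have lt_d a j : (digit s j a < s j)%N by apply: ltn_digit.
case/(digits_inj (lt_d m) (lt_d m')) => <- eq_d; congr (_, _).
rewrite -(sum_digit_small lt_m1) -[RHS](sum_digit_small lt_m2).
by apply: eq_bigr => j _; rewrite eq_d.
Qed.

End Tower.

(** * The valuation attached to a family of valued elements *)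

Section ValuationOfValues.

Variables (k K : fieldType) (iota : {rmorphism k -> K}).
Variables (I : eqType) (E : I -> K) (v : I -> rat).
Local Notation lincomb := (comb iota E).
Local Notation above := (above iota E v).
Local Notation has_value := (has_value iota E v).

Hypothesis E_frac : forall f, exists s t, lincomb t != 0 /\ f = lincomb s / lincomb t.
Hypothesis v_inj : injective v.

Lemma ex_min_value (s : seq (k * I)) : s != [::] ->
  exists2 p, p \in s & {in s, forall p', v p.2 <= v p'.2}.
Proof.
elim: s => // p s IH _; case: (eqVneq s [::]) => [->|/IH[p' ps' min_p']].
  by exists p; rewrite ?mem_head // => p'; rewrite inE => /eqP->.
case: (leP (v p.2) (v p'.2)) => [le_p|/ltW le_p].
  exists p; rewrite ?mem_head // => p1; rewrite inE => /orP[/eqP->//|].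
  by move/min_p'; apply: le_trans.
exists p'; rewrite ?inE ?ps' ?orbT // => p1.
by rewrite inE => /orP[/eqP->//|]; apply: min_p'.
Qed.

(** Collect the terms of least value: by injectivity of v they all involve the same
    member of E, so they either give a leading term or cancel altogether, leaving a
    shorter combination. *)
Lemma comb_value s : lincomb s = 0 \/ exists u, has_value u (lincomb s).
Proof.
have [N] := ubnP (size s); elim: N s => // N IH s lt_s.
case: (eqVneq s [::]) => [->|/ex_min_value[[c i] si min_i]].
  by left; rewrite /comb big_nil.
pose C := \sum_(p <- s | p.2 == i) p.1.
pose s' := [seq p <- s | p.2 != i].
have combE : lincomb s = lincomb s' + iota C * E i.
  rewrite addrC [LHS](bigID (fun p => p.2 == i)) /= /comb big_filter.
  congr (_ + _); rewrite rmorph_sum mulr_suml.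
  by apply: eq_bigr => p /eqP->.
case: (eqVneq C 0) => [C0|C_neq0].
  rewrite combE C0 rmorph0 mul0r addr0; apply: IH.
  have : (0 < count (fun p => p.2 == i) s)%N.
    by rewrite -has_count; apply/hasP; exists (c, i) => /=.
  have -> : size s' = count (predC (fun p => p.2 == i)) s by rewrite size_filter.
  by move: lt_s; rewrite -(count_predC (fun p => p.2 == i) s); lia.
right; exists (v i); exists C, i; split=> //; exists s'; last by rewrite combE addrK.
move=> p; rewrite mem_filter => /andP[neq_i /min_i le_i].
by rewrite lt_neqAle le_i andbT; apply: contra neq_i => /eqP/v_inj->.
Qed.

Section Uniqueness.

Variable nu : K -> rat.
Hypothesis nu_val : is_valuation nu.
Hypothesis nu_iota : forall c, c != 0 -> nu (iota c) = 0.
Hypothesis E_neq0 : forall i, E i != 0.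
Hypothesis nu_E : forall i, nu (E i) = v i.

Lemma nu_above u h : above u h -> h = 0 \/ u < nu h.
Proof.
case=> s + ->; elim: s => [|p s IH] Hs; first by left; rewrite /comb big_nil.
have {IH} : lincomb s = 0 \/ u < nu (lincomb s).
  by apply: IH => p' ps; apply: Hs; rewrite inE ps orbT.
rewrite /comb big_cons -!/(lincomb _) => IH.
case: (eqVneq p.1 0) => [->|p0]; first by rewrite rmorph0 mul0r add0r.
have lt_p : u < nu (iota p.1 * E p.2).
  by rewrite (valuationM nu_val) ?fmorph_eq0 // nu_iota // add0r nu_E Hs ?mem_head.
case: IH => [->|lt_u]; first by right; rewrite addr0.
case: (eqVneq (lincomb s) 0) => [->|s0]; first by right; rewrite addr0.
case: (eqVneq (iota p.1 * E p.2 + lincomb s) 0) => [->|ps0]; first by left.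
right; apply: lt_le_trans (nu_val.2 _ _ _ s0 ps0); first by rewrite lt_min lt_p.
by rewrite mulf_neq0 ?fmorph_eq0.
Qed.

Lemma nu_value u f : has_value u f -> nu f = u.
Proof.
case=> c [i [c0 <- /nu_above]]; set M := iota c * E i => HM.
have M0 : M != 0 by rewrite mulf_neq0 ?fmorph_eq0.
have vM : nu M = v i by rewrite (valuationM nu_val) ?fmorph_eq0 // nu_iota // add0r.
have HM' : f - M = 0 \/ nu M < nu (f - M) by rewrite vM.
have [_] := valuation_dominant nu_val M0 HM'.
by rewrite [M + _]addrC subrK vM.
Qed.

End Uniqueness.

Lemma valuation_unique nu nu' :
  is_valuation nu -> is_valuation nu' ->
  (forall c, c != 0 -> nu (iota c) = 0) -> (forall c, c != 0 -> nu' (iota c) = 0) ->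
  (forall i, E i != 0) ->
  (forall i, nu (E i) = v i) -> (forall i, nu' (E i) = v i) ->
  forall f, f != 0 -> nu f = nu' f.
Proof.
move=> nuV nuV' nu1 nu1' E0 nuE nuE' f f0.
have eq_comb s : lincomb s != 0 -> nu (lincomb s) = nu' (lincomb s).
  case: (comb_value s) => [->|[u Hu] _]; first by rewrite eqxx.
  by rewrite (nu_value nuV _ _ _ Hu) // (nu_value nuV' _ _ _ Hu).
case: (E_frac f) => s [t [t0 Ef]].
have s0 : lincomb s != 0 by apply: contraNneq f0 => s0; rewrite Ef s0 mul0r.
have Es : lincomb s = f * lincomb t by rewrite Ef divfK.
have := nuV.1 f (lincomb t) f0 t0; have := nuV'.1 f (lincomb t) f0 t0.
by rewrite -Es !eq_comb // => ->; move/addIr.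
Qed.

Hypothesis valueEM : forall i j, has_value (v i + v j) (E i * E j).
Hypothesis E_indep : forall i, ~ above (v i) (E i).

(** This is where linear independence enters, through [E_indep]: a leading term cannot
    be rewritten with larger values. *)
Lemma value_not_above u f : has_value u f -> ~ above u f.
Proof.
move=> [c [i [c0 vi Hf]]] Hf'; apply: (@E_indep i); rewrite vi.
have -> : E i = iota c^-1 * (f - (f - iota c * E i)).
  by rewrite subKr mulrA -rmorphM mulVf // rmorph1 mul1r.
by apply/aboveZ/aboveB.
Qed.

Lemma value_neq0 u f : has_value u f -> f != 0.
Proof. by move=> Hf; apply/eqP=> f0; apply: (value_not_above Hf); rewrite f0; apply: above0. Qed.

Lemma value_fun u u' f : has_value u f -> has_value u' f -> u = u'.
Proof.
wlog lt_u : u u' / u < u'.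
  move=> H Hu Hu'; case: (ltgtP u u') => // lt_u; first exact: H.
  by symmetry; apply: H.
by move=> /value_not_above nH /(value_above lt_u).
Qed.

(** The value of a fraction is defined as a relation, since an element of K is the
    quotient of two combinations of E in many ways. *)
Definition frac_value (f : K) (u : rat) : Prop :=
  exists a b ua ub, [/\ has_value ua a, has_value ub b, f = a / b & u = ua - ub].

Lemma frac_value_fun f u u' : frac_value f u -> frac_value f u' -> u = u'.
Proof.
move=> [a [b [ua [ub [Ha Hb -> ->]]]]] [a' [b' [ua' [ub' [Ha' Hb' Ef ->]]]]].
have [b0 b0'] := (value_neq0 Hb, value_neq0 Hb').
have eq_ab : a * b' = a' * b.
  have := congr1 (fun x => x * b * b') Ef.
  by rewrite divfK // => ->; rewrite mulrAC divfK.
have := valueM valueEM Ha Hb'; rewrite eq_ab => H.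
have := value_fun H (valueM valueEM Ha' Hb); lra.
Qed.

Lemma frac_value_ex f : f != 0 -> exists u, frac_value f u.
Proof.
case: (E_frac f) => s [t [t0 ->]] f0.
case: (comb_value s) f0 => [->|[u Hu] _]; first by rewrite mul0r eqxx.
case: (comb_value t) t0 => [->|[w Hw] _]; first by rewrite eqxx.
by exists (u - w), (lincomb s), (lincomb t), u, w.
Qed.

Definition nu_of (f : K) : rat := epsilon (inhabits 0) (frac_value f).

Lemma nu_ofP f : f != 0 -> frac_value f (nu_of f).
Proof. by move/frac_value_ex; apply: epsilon_spec. Qed.

Hypothesis value1 : has_value 0 1.

Lemma nu_of_value u f : has_value u f -> nu_of f = u.
Proof.
move=> Hf; apply: frac_value_fun (nu_ofP (value_neq0 Hf)) _.
by exists f, 1, u, 0; rewrite divr1 subr0.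
Qed.

(** For the sum, clear denominators: if the sum had a value smaller than both summands,
    its numerator would both have a value and consist of terms of larger value. *)
Lemma nu_of_valuation : is_valuation nu_of.
Proof.
split=> a b a0 b0.
  have [f [g [uf [ug [Hf Hg Ea ->]]]]] := nu_ofP a0.
  have [f' [g' [uf' [ug' [Hf' Hg' Eb ->]]]]] := nu_ofP b0.
  apply: frac_value_fun (nu_ofP (mulf_neq0 a0 b0)) _.
  exists (f * f'), (g * g'), (uf + uf'), (ug + ug'); split; try exact: valueM.
    by rewrite Ea Eb invfM mulrACA.
  by ring.
move=> ab0.
have [f [g [uf [ug [Hf Hg Ea Eu]]]]] := nu_ofP a0.
have [f' [g' [uf' [ug' [Hf' Hg' Eb Ew]]]]] := nu_ofP b0.
have [h [l [uh [ul [Hh Hl Eab ->]]]]] := nu_ofP ab0.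
rewrite leNgt; apply/negP; rewrite lt_min Eu Ew => /andP[lt1 lt2].
have [[g0 g0'] l0] := (value_neq0 Hg, value_neq0 Hg', value_neq0 Hl).
have eq_h : h * (g * g') = (f * g' + f' * g) * l.
  have <- : (a + b) * l = h by rewrite Eab divfK.
  have -> : f = a * g by rewrite Ea divfK.
  have -> : f' = b * g' by rewrite Eb divfK.
  by ring.
have := valueM valueEM Hh (valueM valueEM Hg Hg'); rewrite eq_h mulrDl.
move/value_not_above; apply; apply: aboveD.
  apply: value_above (valueM valueEM (valueM valueEM Hf Hg') Hl); lra.
apply: value_above (valueM valueEM (valueM valueEM Hf' Hg) Hl); lra.
Qed.

End ValuationOfValues.

(** * The numerical data *)

Section IntegerSpans.

Implicit Types (g : nat -> rat) (r t : rat).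

Definition zspan (g : nat -> rat) (n : nat) (r : rat) : Prop :=
  exists h : nat -> int, r = \sum_(j < n) (h j)%:~R * g j.

Lemma inIntSpanE g n r : inIntSpan [tuple g j | j < n] r <-> zspan g n r.
Proof.
have eq_sum (a : 'I_n -> int) : \sum_(i < n) [tuple g j | j < n]`_i *~ a i
    = \sum_(i < n) (a i)%:~R * g i.
  apply: eq_bigr => i _.
  by rewrite -(tnth_nth 0 [tuple g j | j < n] i) tnth_mktuple mulrzl.
split=> [[a ->]|[h ->]].
  exists (fun j => if insub j is Some i then a i else 0).
  by rewrite eq_sum; apply: eq_bigr => i _; rewrite valK.
exists [ffun i : 'I_n => h i]; rewrite eq_sum.
by apply: eq_bigr => i _; rewrite ffunE.
Qed.

Lemma zspan0 g n : zspan g n 0.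
Proof. by exists (fun=> 0); rewrite big1 // => j _; rewrite mul0r. Qed.

Lemma zspanD g n r t : zspan g n r -> zspan g n t -> zspan g n (r + t).
Proof.
move=> [h ->] [h' ->]; exists (fun j => h j + h' j); rewrite -big_split.
by apply: eq_bigr => j _; rewrite rmorphD mulrDl.
Qed.

Lemma zspanZ g n (c : int) r : zspan g n r -> zspan g n (c%:~R * r).
Proof.
move=> [h ->]; exists (fun j => c * h j); rewrite mulr_sumr.
by apply: eq_bigr => j _; rewrite rmorphM mulrA.
Qed.

Lemma zspanB g n r t : zspan g n r -> zspan g n t -> zspan g n (r - t).
Proof.
move=> Hr Ht; rewrite -mulN1r; apply: zspanD => //.
exact: (@zspanZ _ _ (-1)).
Qed.

Lemma zspan_gen g n j : (j < n)%N -> zspan g n (g j).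
Proof.
move=> lt_j; exists (fun l => (l == j)%:Z); rewrite (bigD1 (Ordinal lt_j)) //=.
rewrite eqxx mul1r big1 ?addr0 // => l /negPf; rewrite -val_eqE /= => ->.
by rewrite mul0r.
Qed.

Lemma zspan_sum g n (J : nat) (c : nat -> int) (f : nat -> rat) :
  (forall j, (j < J)%N -> zspan g n (f j)) ->
  zspan g n (\sum_(j < J) (c j)%:~R * f j).
Proof.
move=> Hf; elim/big_ind: _ => [|x y|j _]; [exact: zspan0|exact: zspanD|].
exact/zspanZ/Hf.
Qed.

Lemma zspan_le g m n r : (m <= n)%N -> zspan g m r -> zspan g n r.
Proof.
move=> le_mn [h ->]; apply: zspan_sum => j lt_j; apply: zspan_gen.
exact: leq_trans lt_j le_mn.
Qed.

Lemma zspanS g n r : zspan g n.+1 r <->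
  exists (a : int), zspan (fun j => g j.+1) n (r - a%:~R * g 0%N).
Proof.
split=> [[h ->]|[a [h Er]]].
  exists (h 0%N), (fun j => h j.+1).
  by rewrite big_ord_recl /= addrC addKr.
exists (fun j => if j is j'.+1 then h j' else a).
by rewrite big_ord_recl /= -[X in X = _](subrK (a%:~R * g 0%N)) Er addrC.
Qed.

Lemma commensurable (x y : rat) : y != 0 ->
  exists d (t : int), (0 < d)%N /\ d%:R * x = t%:~R * y.
Proof.
move=> y0; pose z := x / y; exists `|denq z|%N, (numq z); split.
  by rewrite absz_gt0 denq_neq0.
have -> : `|denq z|%N%:R = (denq z)%:~R :> rat.
  by rewrite -[in RHS](gez0_abs (ltW (denq_gt0 z))).
have -> : x = z * y by rewrite divfK.
rewrite mulrA; congr (_ * _); rewrite mulrC -[X in X * _ = _](divq_num_den z).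
by rewrite divfK // intr_eq0 denq_neq0.
Qed.

(** Divide the coefficient of the last generator by s_J and replace the multiple of
    s_J g_J by an element of Gam plus earlier generators; then recurse downwards. *)
Lemma reduce_digits (Gam : rat -> Prop) (g : nat -> rat) (s : nat -> nat) J :
  (forall r t, Gam r -> Gam t -> Gam (r + t)) ->
  (forall (c : int) r, Gam r -> Gam (c%:~R * r)) ->
  (forall j, (j < J)%N -> (0 < s j)%N) ->
  (forall j, (j < J)%N -> exists2 a, Gam a & zspan g j ((s j)%:R * g j - a)) ->
  forall r a, Gam a -> zspan g J (r - a) ->
  exists b a', [/\ Gam a', forall j, (j < J)%N -> (b j < s j)%N
                 & r = a' + lin J g b].
Proof.
move=> GamD GamZ; elim: J => [|J IH] s0 Hs r a Ha [h Er].
  exists (fun=> 0%N), a; split=> //.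
  by apply/eqP; rewrite /lin big_ord0 addr0 -subr_eq0 Er big_ord0.
have [a1 Ha1 Ha1'] := Hs J (ltnSn J).
have sJ := s0 J (ltnSn J).
pose c := (h J %/ (s J)%:Z)%Z; pose d := (h J %% (s J)%:Z)%Z.
have d0 : 0 <= d by apply: modz_ge0; rewrite -lt0n.
have ltd : (`|d| < s J)%N by rewrite -ltz_nat gez0_abs // ltz_pmod.
have Hz : zspan g J (r - `|d|%N%:R * g J - (a + c%:~R * a1)).
  have -> : r - `|d|%N%:R * g J - (a + c%:~R * a1)
      = \sum_(j < J) (h j)%:~R * g j + c%:~R * ((s J)%:R * g J - a1).
    have -> : r = a + \sum_(j < J.+1) (h j)%:~R * g j by rewrite -Er addrC subrK.
    rewrite big_ord_recr /= [h J](divz_eq _ (s J)%:Z) -/c -/d.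
    have -> : `|d|%N%:R = d%:~R :> rat by rewrite -[in RHS](gez0_abs d0).
    by rewrite rmorphD rmorphM /=; ring.
  by apply: zspanD; [exists h|apply: zspanZ].
have s0' j : (j < J)%N -> (0 < s j)%N by move/ltnW/s0.
have [b [a' [Ha' ltb Eb]]] := IH s0' (fun j lt_j => Hs j (ltnW lt_j)) _ _
  (GamD _ _ Ha (GamZ c _ Ha1)) Hz.
exists (fun j => if j == J then `|d|%N else b j), a'; split=> //.
  move=> j; rewrite ltnS leq_eqVlt; case: eqP => [->//|_] /=; exact: ltb.
rewrite /lin big_ord_recr /= eqxx addrA.
rewrite (eq_bigr (fun j : 'I_J => (b j)%:R * g j)) -/(lin J g b); last first.
  by move=> j _; rewrite (ltn_eqF (ltn_ord j)).
by rewrite -Eb subrK.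
Qed.

End IntegerSpans.

Lemma leastP (P : nat -> Prop) : (exists n, P n) -> is_least P (least P).
Proof.
move=> exP; apply: (epsilon_spec (inhabits 0%N) (is_least P)).
pose p n := if excluded_middle_informative (P n) then true else false.
have pP n : p n <-> P n by rewrite /p; case: excluded_middle_informative.
have exp : exists n, p n by case: exP => n /pP; exists n.
case: (ex_minnP exp) => n /pP Pn min_n; exists n.
by split=> // m /pP; apply: min_n.
Qed.

Section Numerics.

Variables beta gam : nat -> rat.
Hypothesis beta_gt0 : forall i : nat, 0 < beta i.
Hypothesis beta_lt : forall i : nat, (0 < i)%N -> (q beta i)%:R * beta i < beta i.+1.

Let beta' j := beta j.+1.
Let gam' j := gam j.+1.

Lemma grpGE i r : grpG beta i r <-> zspan beta i.+1 r.
Proof. exact: inIntSpanE. Qed.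

Lemma grpHE i r : grpH gam i r <-> zspan gam' i r.
Proof. exact: (inIntSpanE gam'). Qed.

Lemma grpG_le i j r : (i <= j)%N -> grpG beta i r -> grpG beta j r.
Proof. by move=> le_ij /grpGE Hr; apply/grpGE; apply: zspan_le Hr. Qed.

Lemma q_least i : is_least
  (fun d => (0 < d)%N /\ grpG beta i (d%:R * beta' i)) (q beta i.+1).
Proof.
apply: leastP; have [d [t [d0 Ed]]] := commensurable (beta' i) (lt0r_neq0 (beta_gt0 0)).
by exists d; split=> //; apply/grpGE/zspanS; exists t; rewrite Ed subrr; apply: zspan0.
Qed.

Lemma q_gt0 i : (0 < q beta i.+1)%N.
Proof. by case: (q_least i) => [[]]. Qed.

Lemma grpG_digits i r : grpG beta i r ->
  exists b (a : int), (forall j, (j < i)%N -> (b j < q beta j.+1)%N) /\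
    r = a%:~R * beta 0%N + lin i beta' b.
Proof.
move=> /grpGE/zspanS[a Ha].
have [||||||b [_ [[a' ->] ltb ->]]] := @reduce_digits
  (fun x => exists c : int, x = c%:~R * beta 0%N) beta' (q beta \o succn) i
  _ _ _ _ r (a%:~R * beta 0%N) _ _ => //.
- by move=> _ _ [c ->] [d ->]; exists (c + d); rewrite rmorphD mulrDl.
- by move=> c _ [d ->]; exists (c * d); rewrite rmorphM mulrA.
- by move=> j _; apply: q_gt0.
- move=> j _; have [[_ /grpGE/zspanS[c Hc]] _] := q_least j.
  by exists (c%:~R * beta 0%N); first exists c.
- by exists a.
by exists b, a'.
Qed.

Definition expP0 j : int := expP beta j.+1 0%N.
Definition expP' j l : nat := `|expP beta j.+1 l.+1|%N.

Lemma expP_spec j :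
  (forall l, (l < j)%N -> 0 <= expP beta j.+1 l.+1 < (q beta l.+1)%:Z) /\
  (q beta j.+1)%:R * beta' j = (expP0 j)%:~R * beta 0%N + lin j beta' (expP' j).
Proof.
have : is_expP beta j.+1 (expP beta j.+1).
  apply: epsilon_spec; have [[_ Hq] _] := q_least j.
  have [b [a [ltb Eb]]] := grpG_digits Hq.
  exists (fun l => if l is l'.+1 then (b l')%:Z else a); split.
    by case=> // l /= lt_l; rewrite ltz_nat ltb.
  rewrite big_mkord big_ord_recl /= Eb; congr (_ + _).
case=> lt_n; rewrite big_mkord big_ord_recl /= => ->.
have Hn l : (l < j)%N -> 0 <= expP beta j.+1 l.+1 < (q beta l.+1)%:Z.
  by move=> lt_l; apply: lt_n.
split=> //; congr (_ + _); apply: eq_bigr => l _; congr (_ * _).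
have /andP[n0 _] := Hn l (ltn_ord l).
by rewrite /expP' -[in LHS](gez0_abs n0).
Qed.

Lemma ltn_expP' j l : (l < j)%N -> (expP' j l < q beta l.+1)%N.
Proof.
move=> lt_l; have [/(_ l lt_l)/andP[n0 ltn] _] := expP_spec j.
by rewrite /expP' -ltz_nat gez0_abs.
Qed.

(** Telescoping: (q_l - 1) beta_l + beta_l = q_l beta_l < beta_{l+1}. *)
Lemma lin_lt_beta j b : (forall l, (l < j)%N -> (b l < q beta l.+1)%N) ->
  lin j beta' b < beta' j.
Proof.
elim: j => [|j IH] ltb; first by rewrite /lin big_ord0; apply: beta_gt0.
rewrite /lin big_ord_recr /= -/(lin j beta' b).
have {IH} IH := IH (fun l lt_l => ltb l (ltnW lt_l)).
apply: le_lt_trans (@beta_lt j.+1 isT); rewrite -/(beta' j).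
have : ((b j).+1%:R <= (q beta j.+1)%:R :> rat) by rewrite ler_nat ltb.
have := beta_gt0 j.+1; rewrite -/(beta' j) -natr1; nra.
Qed.

(** The digits contribute less than beta_{j+1} <= q_{j+1} beta_{j+1}, so that the
    multiple of beta_0 makes up for a positive difference.  The exponent of x in
    the recursion is therefore not altered by the absolute value. *)
Lemma expP0_gt0 j : 0 < expP0 j.
Proof.
have [_ Eq] := expP_spec j.
have lt1 := lin_lt_beta (@ltn_expP' j).
have q1 : (1 <= (q beta j.+1)%:R :> rat) by rewrite ler1n q_gt0.
have b0 := beta_gt0 j.+1; rewrite -/(beta' j) in b0.
have : 0 < (expP0 j)%:~R * beta 0%N by nra.
by rewrite pmulr_lgt0 // ltr0z.
Qed.

Lemma q_min j D (h : nat -> int) (a : int) : (0 < D)%N ->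
  D%:R * beta' j = a%:~R * beta 0%N + \sum_(l < j) (h l)%:~R * beta' l ->
  (q beta j.+1 <= D)%N.
Proof.
move=> D0 ED; apply: (q_least j).2; split=> //; apply/grpGE/zspanS; exists a.
by exists h; rewrite ED addrC addKr.
Qed.

Lemma sbar_least i : is_least (fun d => (0 < d)%N /\
  addgrp (grpH gam i) (grpGoo beta) (d%:R * gam' i)) (sbar beta gam i.+1).
Proof.
apply: leastP; have [d [t [d0 Ed]]] := commensurable (gam' i) (lt0r_neq0 (beta_gt0 0)).
exists d; split=> //; exists 0, (t%:~R * beta 0%N); split; rewrite ?add0r //.
  exact/grpHE/zspan0.
by exists 0%N; apply/grpGE/zspanS; exists t; rewrite subrr; apply: zspan0.
Qed.

Lemma sbar_gt0 i : (0 < sbar beta gam i.+1)%N.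
Proof. by case: (sbar_least i) => [[]]. Qed.

Lemma sbar_min j D (h : nat -> int) i r : (0 < D)%N -> grpG beta i r ->
  D%:R * gam' j = r + \sum_(l < j) (h l)%:~R * gam' l ->
  (sbar beta gam j.+1 <= D)%N.
Proof.
move=> D0 Hr ED; apply: (sbar_least j).2; split=> //.
exists (\sum_(l < j) (h l)%:~R * gam' l), r; split; last by rewrite addrC.
  by apply/grpHE; exists h.
by exists i.
Qed.

Lemma leq_mbar i j : (i <= j)%N -> (mbar beta gam i <= mbar beta gam j)%N.
Proof.
move=> /subnK <-; elim: (j - i)%N => // n IH.
by rewrite addSn /= (leq_trans IH) // leq_maxl.
Qed.

Lemma mbar_spec i : addgrp (grpH gam i) (grpG beta (mbar beta gam i.+1))
  ((sbar beta gam i.+1)%:R * gam' i).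
Proof.
have [[_ [a [b [Ha [j Hb] Eab]]]] _] := sbar_least i.
have [|[a' [b' [Ha' Hb' E']]] _] := @leastP (fun j =>
  addgrp (grpH gam i) (grpG beta j) ((sbar beta gam i.+1)%:R * gam' i)).
  by exists j, a, b.
exists a', b'; split=> //; apply: grpG_le Hb'; exact: leq_maxr.
Qed.

Definition nbar' j l : nat := nbar beta gam j.+1 l.+1.
Definition lbar' j l : nat := lbar beta gam j.+1 l.+1.

(** First reduce modulo the group of the beta_l, l <= mbar_{j+1}; it contains what is
    needed at the earlier stages because mbar is nondecreasing.  Then reduce the
    remaining element of that group. *)
Lemma expQ_spec j :
  [/\ forall l, (l < mbar beta gam j.+1)%N -> (nbar' j l < q beta l.+1)%N,
      forall l, (l < j)%N -> (lbar' j l < sbar beta gam l.+1)%N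
    & (sbar beta gam j.+1)%:R * gam' j
      = (acoef beta gam j.+1)%:~R * beta 0%N
        + lin (mbar beta gam j.+1) beta' (nbar' j) + lin j gam' (lbar' j)].
Proof.
have : is_expQ beta gam j.+1 (expQ beta gam j.+1).
  apply: epsilon_spec; have [x [y [Hx Hy Exy]]] := mbar_spec j.
  have [||||||b [r [Hr ltb Er]]] := @reduce_digits
    (grpG beta (mbar beta gam j.+1)) gam' (sbar beta gam \o succn) j
    _ _ _ _ ((sbar beta gam j.+1)%:R * gam' j) y _ _ => //.
  - by move=> ? ? /grpGE ? /grpGE ?; apply/grpGE/zspanD.
  - by move=> ? ? /grpGE ?; apply/grpGE/zspanZ.
  - by move=> l _; apply: sbar_gt0.
  - move=> l lt_l; have [x' [y' [Hx' Hy' E']]] := mbar_spec l.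
    exists y'; first by apply: grpG_le Hy'; apply/leq_mbar/ltnW.
    by rewrite /= E' addrK; apply/grpHE.
  - by rewrite Exy addrK; apply/grpHE.
  have [c [a [ltc Ec]]] := grpG_digits Hr.
  exists (a, c \o predn, b \o predn); split.
  - by case.
  - by case.
  by rewrite -/(gam' j) Er Ec /lin !big_add1 !big_mkord.
rewrite /nbar' /lbar' /nbar /lbar /acoef /=.
case: (expQ beta gam j.+1) => [[a c] b] /= [ltc ltb Es]; split.
- by move=> l lt_l; apply: ltc.
- by move=> l lt_l; apply: ltb.
by move: Es; rewrite !big_add1 !big_mkord.
Qed.

End Numerics.

(** * Linear independence through degrees *)

Section Degrees.

Variable R : idomainType.
Implicit Types (p r : {poly R}) (T : nat -> {poly R}).

Lemma size_mulS p r a b :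
  size p = a.+1 -> size r = b.+1 -> size (p * r) = (a + b).+1.
Proof.
move=> sp sr; rewrite size_mul -?size_poly_gt0 ?sp ?sr //.
by rewrite addSn addnS.
Qed.

Lemma size_expS p a e : size p = a.+1 -> size (p ^+ e) = (e * a).+1.
Proof.
move=> sp; elim: e => [|e IH]; first by rewrite size_poly1.
by rewrite exprS (size_mulS sp IH).
Qed.

Lemma size_mon J T b (d : nat -> nat) :
  (forall j, (j < J)%N -> size (T j) = (d j).+1) ->
  size (mon J T b) = (lin J d b).+1.
Proof.
elim: J => [|J IH] sT; first by rewrite /mon /lin !big_ord0 size_poly1.
rewrite /mon /lin !big_ord_recr /= -/(mon J T b) -/(lin J d b) natn.
have sJ := IH (fun j lt_j => sT j (ltnW lt_j)).
exact: size_mulS sJ (size_expS _ (sT J (ltnSn J))).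
Qed.

(** The subtracted monomial has standard exponents, so its degree is smaller than that of
    T_j, and the leading term comes from T_j^{s_j} alone. *)
Lemma size_tower T (s : nat -> nat) (n : nat -> nat -> nat) (u w : nat -> R) :
  (forall j l, (l < j)%N -> (n j l < s l)%N) ->
  (forall j, (0 < s j)%N) ->
  (forall j, w j != 0) -> size (T 0%N) = 2%N ->
  (forall j, T j.+1 = (w j)%:P * T j ^+ s j - (u j)%:P * mon j T (n j)) ->
  forall j, size (T j) = (radix s j).+1.
Proof.
move=> ltn_n s0 w0 T0 TS; elim/ltn_ind=> -[|j] IH; first by rewrite T0 /radix big_ord0.
have sj := IH j (ltnSn j).
have sw : size (w j)%:P = 1%N by rewrite size_polyC w0.
have s1 := size_mulS sw (size_expS (s j) sj); rewrite add0n mulnC -radixS in s1.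
rewrite TS size_polyDl ?s1 // size_polyN.
have sm : size (mon j T (n j)) = (lin j (radix s) (n j)).+1.
  by apply: size_mon => l lt_l; apply/IH/ltnW.
have lt_m : (lin j (radix s) (n j) < radix s j)%N.
  by rewrite lin_nat; apply: ltn_sum_digits => l; apply: ltn_n.
rewrite ltnS; apply: leq_trans (leq_radix s0 (leqnSn j)).
apply: leq_trans (size_polyMleq _ _) _; rewrite sm size_polyC.
by apply: leq_trans lt_m; case: eqP => //= _; rewrite leqnSn.
Qed.

Lemma size_stdmon T (s len : nat -> nat) m :
  (forall m', (m' < radix s (len m'))%N) ->
  (forall j, size (T j) = (radix s j).+1) -> size (stdmon s len T m) = m.+1.
Proof.
move=> ltn_len sT; rewrite /stdmon (@size_mon _ _ _ (radix s)) //.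
by rewrite lin_nat sum_digit_small.
Qed.

Lemma sum_poly_eq0 (Z : nat -> {poly R}) N (a : nat -> R) :
  (forall m, size (Z m) = m.+1) ->
  \sum_(m < N) (a m)%:P * Z m = 0 -> forall m, (m < N)%N -> a m = 0.
Proof.
move=> sZ; elim: N => // N IH; rewrite big_ord_recr /= => sum0.
have aN : a N = 0.
  move/(congr1 (fun p => p`_N)): sum0; rewrite coefD coefCM coef0 coef_sum.
  rewrite big1 ?add0r => [/eqP|m _].
    rewrite mulf_eq0 => /orP[/eqP //|].
    have := lead_coef_eq0 (Z N); rewrite lead_coefE sZ /= => ->.
    by rewrite -size_poly_eq0 sZ.
  by rewrite coefCM nth_default ?mulr0 // sZ ltn_ord.
move: sum0; rewrite aN mul0r addr0 => /IH a0 m.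
by rewrite ltnS leq_eqVlt => /orP[/eqP->|/a0].
Qed.

End Degrees.

Section Independence.

(** Coefficients are collected by index, so that a repeated index in s is allowed. *)
Definition independent (k : fieldType) (R : nzRingType) (iota : k -> R) (I : eqType)
    (E : I -> R) : Prop :=
  forall s : seq (k * I), \sum_(p <- s) iota p.1 * E p.2 = 0 ->
  forall i, \sum_(p <- s | p.2 == i) p.1 = 0.

(** Sort the relation by the degree m of Z_m: the Z_m are independent over R, so each
    coefficient vanishes, and it is a relation in the base family. *)
Lemma independent_poly (k : fieldType) (R : idomainType) (iota : k -> R)
    (I : eqType) (E : I -> R) (Z : nat -> {poly R}) :
  (forall m, size (Z m) = m.+1) -> independent iota E ->
  independent (polyC \o iota) (fun p : I * nat => (E p.1)%:P * Z p.2).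
Proof.
move=> sZ indE s sum0 [i m].
pose M := (\max_(p <- s) p.2.2).+1.
have ltM p : p \in s -> (p.2.2 < M)%N.
  by move=> ps; rewrite ltnS (@leq_bigmax_seq _ _ xpredT (fun p => p.2.2)).
pose a m' := \sum_(p <- s | p.2.2 == m') iota p.1 * E p.2.1.
have a0 m' : (m' < M)%N -> a m' = 0.
  apply: (sum_poly_eq0 sZ); rewrite -[RHS]sum0.
  under eq_bigr do rewrite /a rmorph_sum mulr_suml /= big_mkcond.
  rewrite exchange_big /= big_seq [RHS]big_seq; apply: eq_bigr => p /ltM lt_p.
  rewrite -big_mkcond (big_pred1 (Ordinal lt_p)) => [|j]; last by rewrite eq_sym.
  by rewrite polyCM mulrA.
case: (ltnP m M) => [/a0 am0|leM]; last first.
  rewrite big_seq_cond big1 // => p /andP[/ltM lt_p /eqP Ep].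
  by move: lt_p; rewrite Ep ltnNge leM.
pose s' := [seq (p.1, p.2.1) | p <- s & p.2.2 == m].
have := indE s'; rewrite big_map big_filter => /(_ am0 i).
rewrite big_map big_filter_cond /= => sum_i; rewrite -[RHS]sum_i; apply: eq_bigl.
by move=> [c [i' m']]; rewrite xpair_eqE andbC.
Qed.

(** Members of larger value differ from E i, so that the coefficient of E i in the
    relation would be -1. *)
Lemma independent_not_above (k K : fieldType) (iota : {rmorphism k -> K}) (I : eqType)
    (E : I -> K) (v : I -> rat) :
  independent iota E -> forall i, ~ above iota E v (v i) (E i).
Proof.
move=> indE i [s Hs Es].
have := indE ((-1, i) :: s); rewrite big_cons /= rmorphN1 mulN1r.
rewrite {1}Es addNr => /(_ erefl i); rewrite big_cons eqxx.
rewrite big_seq_cond big1 => [/eqP|p /andP[ps /eqP Ep]].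
  by rewrite addr0 oppr_eq0 (negPf (oner_neq0 _)).
by have := Hs p ps; rewrite Ep ltxx.
Qed.

End Independence.

(** * Standard monomials in k[x,y,z] *)

Lemma rmorph_mon (R S : comNzRingType) (phi : {rmorphism R -> S}) J Q b :
  phi (mon J Q b) = mon J (phi \o Q) b.
Proof. by rewrite rmorph_prod; apply: eq_bigr => j _; rewrite rmorphXn. Qed.

Lemma rmorph_stdmon (R S : comNzRingType) (phi : {rmorphism R -> S}) s len Q m :
  phi (stdmon s len Q m) = stdmon s len (phi \o Q) m.
Proof. exact: rmorph_mon. Qed.

Lemma eq_mon_fun (R : comNzRingType) J (Q Q' : nat -> R) b :
  (forall j, (j < J)%N -> Q j = Q' j) -> mon J Q b = mon J Q' b.
Proof. by move=> eqQ; apply: eq_bigr => j _; rewrite eqQ. Qed.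

Section Recursion.

Variables (k : fieldType) (beta gam : nat -> rat) (lam mu : nat -> k).

Definition polP (j : nat) : {mpoly k[3]} := defP beta lam j.+1.
Definition polQ (j : nat) : {mpoly k[3]} := defQ beta gam lam mu j.+1.

Lemma polP0 : polP 0 = vary k. Proof. exact: defP1. Qed.
Lemma polQ0 : polQ 0 = varz k. Proof. exact: defQ1. Qed.

Lemma polPS j : polP j.+1 = polP j ^+ q beta j.+1
  - (lam j.+1)%:MP * varx k ^+ `|expP0 beta j| * mon j polP (expP' beta j).
Proof.
rewrite /polP defPS // big_mkord big_ord_recl /= defP0 -mul_mpolyC mulrA.
by [].
Qed.

Lemma polQS j : polQ j.+1 = varx k ^+ rbar0 beta gam j.+1 * polQ j ^+ sbar beta gam j.+1
  - (mu j.+1)%:MP * varx k ^+ nbar beta gam j.+1 0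
    * mon (mbar beta gam j.+1) polP (nbar' beta gam j)
    * mon j polQ (lbar' beta gam j).
Proof.
rewrite /polQ defQS // big_mkord big_ord_recl defP0 -mul_mpolyC big_add1 big_mkord.
by rewrite !mulrA.
Qed.

End Recursion.

Section PolynomialIndependence.

Variables (k : fieldType) (beta gam : nat -> rat) (lam mu : nat -> k).
Hypothesis beta_gt0 : forall i : nat, 0 < beta i.
Variables len1 len2 : nat -> nat.
Let s1 j := q beta j.+1.
Let s2 j := sbar beta gam j.+1.
Hypothesis ltn_len1 : forall m, (m < radix s1 (len1 m))%N.
Hypothesis ltn_len2 : forall m, (m < radix s2 (len2 m))%N.

Local Notation pP := (polP beta lam).
Local Notation pQ := (polQ beta gam lam mu).

(** Iterated polynomials k[x][y][z] make degrees in z, then y, then x, available. *)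
Definition vars3 (i : 'I_3) : {poly {poly {poly k}}} :=
  if val i == 0%N then 'X%:P%:P else if val i == 1%N then 'X%:P else 'X.

Definition iter_poly : {rmorphism {mpoly k[3]} -> {poly {poly {poly k}}}} :=
  mmap (polyC \o polyC \o polyC) vars3.
Local Notation phi := iter_poly.

Lemma iter_poly_var i : phi 'X_i = vars3 i.
Proof. by rewrite /= mmapX mmap1U. Qed.

Lemma iter_polyC c : phi c%:MP = c%:P%:P%:P.
Proof. by rewrite /= mmapC. Qed.

Lemma iter_polyx : phi (varx k) = 'X%:P%:P.
Proof. by rewrite iter_poly_var /vars3 /= inordK. Qed.
Lemma iter_polyy : phi (vary k) = 'X%:P.
Proof. by rewrite iter_poly_var /vars3 /= inordK. Qed.
Lemma iter_polyz : phi (varz k) = 'X.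
Proof. by rewrite iter_poly_var /vars3 /= inordK. Qed.

(** P_{j+1} does not involve z: its image is the constant polynomial on its own
    constant coefficient. *)
Definition polyP j : {poly {poly k}} := (phi (pP j))`_0.

Lemma iter_polyP j : phi (pP j) = (polyP j)%:P.
Proof.
suff [p Ep] : exists p, phi (pP j) = p%:P by rewrite /polyP Ep coefC.
elim/ltn_ind: j => -[|j] IH; first by exists 'X; rewrite polP0 iter_polyy.
have EP l : (l < j.+1)%N -> phi (pP l) = (polyP l)%:P.
  by move=> /IH[p Ep]; rewrite /polyP Ep coefC.
exists (polyP j ^+ s1 j - ((lam j.+1)%:P * 'X ^+ `|expP0 beta j|)%:P
  * mon j polyP (expP' beta j)).
rewrite polPS rmorphB !rmorphM !rmorphXn iter_polyC iter_polyx EP // rmorph_mon.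
rewrite (@eq_mon_fun _ _ _ (polyC \o polyP)) => [|l lt_l]; last exact/EP/ltnW.
by rewrite -rmorph_mon !(rmorphB, rmorphM, rmorphXn).
Qed.

Lemma polyPS j : polyP j.+1 = 1%:P * polyP j ^+ s1 j
  - ((lam j.+1)%:P * 'X ^+ `|expP0 beta j|)%:P * mon j polyP (expP' beta j).
Proof.
apply: (@polyC_inj _); rewrite -iter_polyP polPS rmorphB !rmorphM !rmorphXn.
rewrite iter_polyC iter_polyx iter_polyP rmorph_mon.
rewrite (@eq_mon_fun _ _ _ (polyC \o polyP)) => [|l lt_l]; last exact: iter_polyP.
by rewrite -rmorph_mon polyC1 mul1r !(rmorphB, rmorphM, rmorphXn).
Qed.

Lemma size_polyP j : size (polyP j) = (radix s1 j).+1.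
Proof.
move: j; apply: size_tower polyPS => //.
- by move=> j l; apply: ltn_expP'.
- by move=> j; apply: q_gt0.
- by move=> j; apply: oner_neq0.
by rewrite /polyP polP0 iter_polyy coefC size_polyX.
Qed.

Lemma iter_polyQS j : phi (pQ j.+1)
  = ('X%:P ^+ rbar0 beta gam j.+1)%:P * phi (pQ j) ^+ s2 j
    - ((mu j.+1)%:P%:P * 'X%:P ^+ nbar beta gam j.+1 0
       * mon (mbar beta gam j.+1) polyP (nbar' beta gam j))%:P
      * mon j (phi \o pQ) (lbar' beta gam j).
Proof.
rewrite polQS rmorphB !rmorphM !rmorphXn iter_polyC iter_polyx !rmorph_mon.
rewrite (@eq_mon_fun _ _ (_ \o pP) (polyC \o polyP)) => [|l lt_l]; last exact: iter_polyP.
by [].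
Qed.

Lemma size_polyQ j : size (phi (pQ j)) = (radix s2 j).+1.
Proof.
move: j; apply: (size_tower (T := phi \o pQ)) iter_polyQS.
- by move=> j l lt_l; have [_ ltl _] := expQ_spec gam beta_gt0 j; apply: ltl.
- by move=> j; apply: sbar_gt0.
- by move=> j; rewrite expf_neq0 // polyC_eq0 polyX_eq0.
by rewrite /= polQ0 iter_polyz size_polyX.
Qed.

Lemma iter_poly_std t n m :
  phi (varx k ^+ t * stdmon s1 len1 pP n * stdmon s2 len2 pQ m)
  = ((1%:P * 'X^t)%:P * stdmon s1 len1 polyP n)%:P * stdmon s2 len2 (phi \o pQ) m.
Proof.
rewrite (rmorphM phi) (rmorphM phi) (rmorphXn phi) iter_polyx.
rewrite (rmorph_stdmon phi) (rmorph_stdmon phi); congr (_ * _).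
rewrite polyC1 mul1r [RHS]polyCM -[in LHS]polyC_exp -[in LHS]polyC_exp; congr (_ * _).
rewrite (rmorph_stdmon polyC).
by apply: eq_mon_fun => l _; apply: iter_polyP.
Qed.

(** Three applications of [independent_poly] adjoin x, y and z in turn, starting from
    the family that consists of 1. *)
Lemma mpoly_independent : independent (@mpolyC 3 k)
  (fun p : nat * nat * nat =>
     varx k ^+ p.1.1 * stdmon s1 len1 pP p.1.2 * stdmon s2 len2 pQ p.2).
Proof.
have ind0 : independent (id : k -> k) (fun _ : unit => 1).
  move=> s + []; under eq_bigr do rewrite mulr1.
  by move=> sum0; rewrite -[RHS]sum0; apply: eq_bigl => -[c []].
have ind1 := independent_poly (@size_polyXn k) ind0.
have ind2 := independent_poly (fun m => size_stdmon m ltn_len1 size_polyP) ind1.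
have ind3 := independent_poly
  (fun m => size_stdmon (T := phi \o pQ) m ltn_len2 size_polyQ) ind2.
move=> s sum0 [[t n] m].
pose s' : seq (k * (unit * nat * nat * nat)) :=
  [seq (p.1, (tt, p.2.1.1, p.2.1.2, p.2.2)) | p <- s].
rewrite -[RHS](ind3 s' _ (tt, t, n, m)).
  by rewrite big_map; apply: eq_bigl => -[c [[t' n'] m']].
rewrite big_map.
have E : \sum_(p <- s) phi ((p.1)%:MP * (varx k ^+ p.2.1.1
    * stdmon s1 len1 pP p.2.1.2 * stdmon s2 len2 pQ p.2.2)) = 0.
  by rewrite -rmorph_sum sum0 rmorph0.
apply: etrans E; apply: eq_bigr => -[c [[t' n'] m']] _.
by rewrite (rmorphM phi) iter_polyC iter_poly_std.
Qed.

End PolynomialIndependence.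

(** * Domination of the local ring at the origin *)

Lemma mpoly3_ind (k : fieldType) (P : {mpoly k[3]} -> Prop) :
  (forall c, P c%:MP) -> (forall f g, P f -> P g -> P (f + g)) ->
  (forall f g, P f -> P g -> P (f * g)) ->
  P (varx k) -> P (vary k) -> P (varz k) -> forall f, P f.
Proof.
move=> PC PD PM Px Py Pz f.
have P0 : P 0 by rewrite -mpolyC0; apply: PC.
have P1 : P 1 by rewrite -mpolyC1; apply: PC.
have PX (i : 'I_3) : P 'X_i.
  case: i => -[|[|[|//]]] lt_i.
  - suff -> : Ordinal lt_i = inord 0 by [].
    by apply: val_inj; rewrite /= inordK.
  - suff -> : Ordinal lt_i = inord 1 by [].
    by apply: val_inj; rewrite /= inordK.
  - suff -> : Ordinal lt_i = inord 2 by [].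
    by apply: val_inj; rewrite /= inordK.
rewrite (mpolyE f); apply: (big_ind P P0 PD) => m _; rewrite -mul_mpolyC; apply: (PM) => //.
rewrite mpolyXE_id; apply: (big_ind P P1 PM) => i _.
by elim: (m i) => [|e IH]; rewrite ?expr0 // exprS; apply: (PM).
Qed.

Section Domination.

Variable k : fieldType.
Local Notation K := (ratfun3 k).
Local Notation tau := (@tofrac {mpoly k[3]}).

Definition const3 : {rmorphism k -> K} := (tau \o @mpolyC 3 k).

Lemma ideal_const (f : {mpoly k[3]}) : exists c, ideal_xyz (f - c%:MP).
Proof.
elim/mpoly3_ind: f => [c|f g [c [a1 [a2 [a3 Ef]]]] [d [b1 [b2 [b3 Eg]]]]
  |f g [c [a1 [a2 [a3 Ef]]]] [d [b1 [b2 [b3 Eg]]]]| | |].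
- by exists c, 0, 0, 0; rewrite subrr; ring.
- exists (c + d), (a1 + b1), (a2 + b2), (a3 + b3).
  by rewrite mpolyCD opprD addrACA Ef Eg; ring.
- exists (c * d), (a1 * g + c%:MP * b1), (a2 * g + c%:MP * b2), (a3 * g + c%:MP * b3).
  have -> : f * g - (c * d)%:MP = (f - c%:MP) * g + c%:MP * (g - d%:MP).
    by rewrite mpolyCM; ring.
  by rewrite Ef Eg; ring.
- by exists 0, 1, 0, 0; rewrite mpolyC0; ring.
- by exists 0, 0, 1, 0; rewrite mpolyC0; ring.
- by exists 0, 0, 0, 1; rewrite mpolyC0; ring.
Qed.

Lemma not_ideal_const c : c != 0 -> ~ ideal_xyz (c%:MP : {mpoly k[3]}).
Proof.
move=> c0 [a1 [a2 [a3]]] /(congr1 (meval (fun=> 0))).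
rewrite mevalC !mevalD !mevalM !mevalXU !mulr0 !addr0 => /eqP.
by rewrite (negPf c0).
Qed.

Lemma loc_xyz_mpoly f : @loc_xyz k (tau f).
Proof.
exists f, 1; split; last by rewrite /tofrac3 rmorph1 divr1.
rewrite -mpolyC1; apply: not_ideal_const; exact: oner_neq0.
Qed.

Variable nu : K -> rat.
Hypothesis nu_val : is_valuation nu.
Hypothesis nu_const : forall c, c != 0 -> nu (const3 c) = 0.
Hypothesis nux : 0 < nu (tau (varx k)).
Hypothesis nuy : 0 < nu (tau (vary k)).
Hypothesis nuz : 0 < nu (tau (varz k)).

Lemma valring_mpoly f : valuation_ring nu (tau f).
Proof.
elim/mpoly3_ind: f => [c|f g|f g| | |].
- exact: (valring_const nu_const c).
- by rewrite rmorphD; apply: valringD.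
- by rewrite rmorphM; apply: valringM.
- by right; apply: ltW.
- by right; apply: ltW.
by right; apply: ltW.
Qed.

Lemma val_pos_ideal f : ideal_xyz f -> val_pos nu (tau f).
Proof.
move=> [a [b [c ->]]]; rewrite !rmorphD !rmorphM.
apply: (val_posD nu_val); first apply: (val_posD nu_val);
  by apply: (val_posM nu_val) (valring_mpoly _) _; right.
Qed.

(** The constant term is nonzero, and the rest has positive value. *)
Lemma nu_not_ideal f : ~ ideal_xyz f -> tau f != 0 /\ nu (tau f) = 0.
Proof.
move=> Nf; have [c Ic] := ideal_const f.
have c0 : c != 0 by apply/eqP => c0; apply: Nf; move: Ic; rewrite c0 mpolyC0 subr0.
have -> : tau f = const3 c + tau (f - c%:MP) by rewrite rmorphB addrC subrK.
have C0 : const3 c != 0 by rewrite fmorph_eq0.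
rewrite -(nu_const c0); apply: (valuation_dominant nu_val C0).
by rewrite nu_const //; apply: val_pos_ideal.
Qed.

Lemma nu_dominates : dominates nu (@loc_xyz k).
Proof.
exact: (dominates_localization nu_val valring_mpoly val_pos_ideal nu_not_ideal).
Qed.

End Domination.

(** * Standard monomials in k(x,y,z) and the valuation *)

(** Each s_j > 1 at least doubles the weight of the following digits. *)
Lemma radix_unbounded (s : nat -> nat) : (forall j, (0 < s j)%N) ->
  (forall N, exists i, (N < i)%N /\ (1 < s i.-1)%N) ->
  exists len, forall m, (m < radix s (len m))%N.
Proof.
move=> s0 s_inf.
have unb m : exists J, (m < radix s J)%N.
  elim: m => [|m [J lt_J]]; first by exists 0%N; rewrite radix_gt0.
  have [[|i] /= [lt_i s1]] := s_inf J; first by [].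
  exists i.+1; rewrite radixS.
  have := leq_radix s0 (lt_i : (J <= i)%N); have := leq_mul (leqnn (radix s i)) s1.
  by lia.
by exists (fun m => ex_minn (unb m)) => m; case: ex_minnP.
Qed.

Lemma fraction_quotient (R : idomainType) (f : {fraction R}) :
  exists a b : R, b != 0 /\ f = tofrac a / tofrac b.
Proof.
elim/quotW: f => r; exists (frac r).1, (frac r).2; have r0 := denom_ratioP r.
split=> //; apply: (canRL (mulfK _)); first by rewrite tofrac_eq0.
rewrite !piE; apply/eqmodP; rewrite /= FracField.equivfE /FracField.mulf.
by rewrite !numden_Ratio ?mulr1 ?oner_neq0 // mulrC.
Qed.

(** The recursion for Q_{j+1} divided by the power xr of x, where e = 1 / xr. *)
Lemma solve_relation (R : comNzRingType) (a e c m n b xr xn : R) :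
  a = xn * e -> e * xr = 1 ->
  b = c * (a * m) * n + e * (xr * b - c * xn * m * n).
Proof. by move=> -> e_xr; rewrite mulrBr (mulrA e xr) e_xr mul1r; ring. Qed.

Section MonomialBasis.

Variables (k : fieldType) (beta gam : nat -> rat) (lam mu : nat -> k).
Hypothesis beta_gt0 : forall i : nat, 0 < beta i.
Hypothesis gam_gt0 : forall i : nat, (0 < i)%N -> 0 < gam i.
Hypothesis beta_lt : forall i : nat, (0 < i)%N -> (q beta i)%:R * beta i < beta i.+1.
Hypothesis gam_lt : forall i : nat, (0 < i)%N ->
  (rbar0 beta gam i)%:R * beta 0%N + (sbar beta gam i)%:R * gam i < gam i.+1.
Hypothesis lam_neq0 : forall i : nat, (0 < i)%N -> lam i != 0.
Hypothesis mu_neq0 : forall i : nat, (0 < i)%N -> mu i != 0.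
Variables len1 len2 : nat -> nat.
Let s1 j := q beta j.+1.
Let s2 j := sbar beta gam j.+1.
Hypothesis ltn_len1 : forall m, (m < radix s1 (len1 m))%N.
Hypothesis ltn_len2 : forall m, (m < radix s2 (len2 m))%N.

Local Notation K := (ratfun3 k).
Local Notation tau := (@tofrac {mpoly k[3]}).
Local Notation iota := (const3 k).
Local Notation x := (tau (varx k)).

Let beta' j := beta j.+1.
Let gam' j := gam j.+1.
Definition fracP (j : nat) : K := tau (polP beta lam j).
Definition fracQ (j : nat) : K := tau (polQ beta gam lam mu j).

Lemma x_neq0 : x != 0.
Proof.
rewrite tofrac_eq0; apply/eqP => /(congr1 (meval (fun=> 1))).
by rewrite mevalXU meval0 => /eqP; rewrite (negPf (oner_neq0 _)).
Qed.

(** The integral powers of x, then their products with standard monomials in the P_j,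
    then also in the Q_j, with the values that a solution has to give them. *)
Definition E0 (t : int) : K := x ^ t.
Definition v0 (t : int) : rat := t%:~R * beta 0%N.
Definition E1 : int * nat -> K := towerE E0 fracP s1 len1.
Definition v1 : int * nat -> rat := towerv v0 beta' s1 len1.
Definition E2 : int * nat * nat -> K := towerE E1 fracQ s2 len2.
Definition v2 : int * nat * nat -> rat := towerv v1 gam' s2 len2.

Local Notation value0 := (has_value iota E0 v0).
Local Notation value1 := (has_value iota E1 v1).
Local Notation value2 := (has_value iota E2 v2).

Lemma v0_inj : injective v0.
Proof.
move=> t t' /(mulIf (lt0r_neq0 (beta_gt0 0))) /eqP.
by rewrite eqr_int => /eqP.
Qed.

Lemma value0EM t t' : value0 (v0 t + v0 t') (E0 t * E0 t').
Proof.
rewrite /v0 /E0 -mulrDl -rmorphD -expfzDr ?x_neq0 //.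
exact: (valueE iota E0 v0 (t + t')).
Qed.

Lemma value0_1 : value0 0 1.
Proof. by have := valueE iota E0 v0 0; rewrite /v0 mul0r. Qed.

Let U1 j : K := iota (lam j.+1) * E0 (expP0 beta j).
Let u1 j : rat := v0 (expP0 beta j).
Let W1 (j : nat) : K := 1.
Let w1 (j : nat) : rat := 0.

Lemma s1_gt0 j : (0 < s1 j)%N. Proof. exact: q_gt0. Qed.

Lemma fracP_rel j : fracP j ^+ s1 j = U1 j * mon j fracP (expP' beta j) + W1 j * fracP j.+1.
Proof.
rewrite /fracP polPS rmorphB !rmorphM !rmorphXn rmorph_mon /U1 /W1 /E0 mul1r.
rewrite -{1}(gez0_abs (ltW (expP0_gt0 beta_gt0 beta_lt j))) -exprnP.
by rewrite addrC subrK.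
Qed.

Lemma value0_U1 j : value0 (u1 j) (U1 j).
Proof. by apply: valueZ; [apply: lam_neq0|apply: valueE]. Qed.

Lemma value0_W1 j : value0 (w1 j) (W1 j). Proof. exact: value0_1. Qed.

Lemma beta_rel j : (s1 j)%:R * beta' j = u1 j + lin j beta' (expP' beta j).
Proof. by case: (expP_spec beta_gt0 j). Qed.

Lemma beta_ltS j : (s1 j)%:R * beta' j < w1 j + beta' j.+1.
Proof. by rewrite add0r; apply: beta_lt. Qed.

Lemma value1EM p p' : value1 (v1 p + v1 p') (E1 p * E1 p').
Proof.
exact: (tower_valueEM value0EM s1_gt0 ltn_len1 (@ltn_expP' _ beta_gt0)
  fracP_rel value0_U1 beta_rel value0_W1 beta_ltS).
Qed.

Lemma value1_base u f : value0 u f -> value1 u f.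
Proof.
exact: (tower_value_base value0EM s1_gt0 ltn_len1 (@ltn_expP' _ beta_gt0)
  fracP_rel value0_U1 beta_rel value0_W1 beta_ltS).
Qed.

Lemma value1_P j : value1 (beta' j) (fracP j).
Proof.
exact: (tower_valueQ value0EM value0_1 s1_gt0 ltn_len1 (@ltn_expP' _ beta_gt0)
  fracP_rel value0_U1 beta_rel value0_W1 beta_ltS).
Qed.

Lemma v1_inj : injective v1.
Proof.
apply: towerv_inj s1_gt0 ltn_len1 v0_inj _ => j D t t' h D0 ED.
by apply: (@q_min beta beta_gt0 j D h (t - t')); rewrite // ED rmorphB mulrBl.
Qed.

Lemma value1_1 : value1 0 1. Proof. exact/value1_base/value0_1. Qed.

Let U2 j : K := iota (mu j.+1) * (E0 (acoef beta gam j.+1)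
  * mon (mbar beta gam j.+1) fracP (nbar' beta gam j)).
Let W2 j : K := E0 (- (rbar0 beta gam j.+1)%:Z).
Let u2 j : rat := v0 (acoef beta gam j.+1)
  + lin (mbar beta gam j.+1) beta' (nbar' beta gam j).
Let w2 j : rat := v0 (- (rbar0 beta gam j.+1)%:Z).

Lemma s2_gt0 j : (0 < s2 j)%N. Proof. exact: sbar_gt0. Qed.

Lemma acoefE i : acoef beta gam i = (nbar beta gam i 0)%:Z - (rbar0 beta gam i)%:Z.
Proof.
rewrite /nbar /rbar0 eqxx !gez0_abs ?le_max ?lexx //.
by case: (ltrgt0P (acoef beta gam i)) => ?; lia.
Qed.

Lemma fracQ_rel j : fracQ j ^+ s2 j
  = U2 j * mon j fracQ (lbar' beta gam j) + W2 j * fracQ j.+1.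
Proof.
rewrite /fracQ polQS rmorphB !rmorphM !rmorphXn !rmorph_mon /U2 /W2.
apply: solve_relation; rewrite /E0.
  by rewrite acoefE expfzDr ?x_neq0.
by rewrite -exprnN mulVf // expf_neq0 ?x_neq0.
Qed.

Lemma value1_U2 j : value1 (u2 j) (U2 j).
Proof.
apply: valueZ; first exact: mu_neq0.
apply: (valueM value1EM); first by apply/value1_base/valueE.
rewrite /lin /mon; apply: (value_prod value1EM) => [|l _]; first exact: value1_1.
exact: (valueX value1EM _ value1_1 (value1_P l)).
Qed.

Lemma value1_W2 j : value1 (w2 j) (W2 j).
Proof. exact/value1_base/valueE. Qed.

Lemma ltn_lbar' j l : (l < j)%N -> (lbar' beta gam j l < s2 l)%N.
Proof. by move=> lt_l; have [_ H _] := expQ_spec gam beta_gt0 j; apply: H. Qed.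

Lemma gam_rel j : (s2 j)%:R * gam' j = u2 j + lin j gam' (lbar' beta gam j).
Proof. by have [_ _ H] := expQ_spec gam beta_gt0 j. Qed.

Lemma gam_ltS j : (s2 j)%:R * gam' j < w2 j + gam' j.+1.
Proof.
have := gam_lt (ltn0Sn j); rewrite /w2 /v0 rmorphN /= mulNr -/(gam' j) -/(gam' j.+1).
by rewrite -/(s2 j) -[_%:~R]/((rbar0 beta gam j.+1)%:R); lra.
Qed.

Lemma value2EM p p' : value2 (v2 p + v2 p') (E2 p * E2 p').
Proof.
exact: (tower_valueEM value1EM s2_gt0 ltn_len2 ltn_lbar'
  fracQ_rel value1_U2 gam_rel value1_W2 gam_ltS).
Qed.

Lemma value2_base u f : value1 u f -> value2 u f.
Proof.
exact: (tower_value_base value1EM s2_gt0 ltn_len2 ltn_lbar'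
  fracQ_rel value1_U2 gam_rel value1_W2 gam_ltS).
Qed.

Lemma value2_Q j : value2 (gam' j) (fracQ j).
Proof.
exact: (tower_valueQ value1EM value1_1 s2_gt0 ltn_len2 ltn_lbar'
  fracQ_rel value1_U2 gam_rel value1_W2 gam_ltS).
Qed.

Lemma v1_grpG p : grpG beta (len1 p.2) (v1 p).
Proof.
apply/grpGE/zspanS; exists p.1; rewrite /v1 /towerv addrC addKr.
by exists (fun j => (digit s1 j p.2)%:Z).
Qed.

(** Values of the lower family lie in the group generated by the beta_j, so that
    the minimality of s_j applies to differences of two of them. *)
Lemma v2_inj : injective v2.
Proof.
apply: towerv_inj s2_gt0 ltn_len2 v1_inj _ => j D p p' h D0 ED.
pose l := maxn (len1 p.2) (len1 p'.2).
apply: (@sbar_min beta gam beta_gt0 j D h l _ D0 _ ED); apply/grpGE/zspanB.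
  by apply/grpGE; apply: grpG_le (v1_grpG p); apply: leq_maxl.
by apply/grpGE; apply: grpG_le (v1_grpG p'); apply: leq_maxr.
Qed.

Lemma value2_1 : value2 0 1. Proof. exact/value2_base/value1_1. Qed.

Lemma value2_P j : value2 (beta' j) (fracP j).
Proof. exact/value2_base/value1_P. Qed.

Lemma value2_x : value2 (beta 0%N) x.
Proof.
have := valueE iota E0 v0 1; rewrite /v0 /E0 mul1r expr1z.
by move/value1_base/value2_base.
Qed.

Lemma value2_const c : c != 0 -> value2 0 (iota c).
Proof. by move=> c0; rewrite -[iota c]mulr1; apply: valueZ value2_1. Qed.

Lemma fracP0 : fracP 0 = tau (vary k). Proof. by rewrite /fracP polP0. Qed.
Lemma fracQ0 : fracQ 0 = tau (varz k). Proof. by rewrite /fracQ polQ0. Qed.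

Lemma mpoly_above f : exists u, above iota E2 v2 u (tau f).
Proof.
have ex_above u g : value2 u g -> exists u', above iota E2 v2 u' g.
  by exists (u - 1); apply: value_above H; rewrite ltrBlDr ltrDl.
elim/mpoly3_ind: f => [c|f g [u Hf] [w Hg]|f g [u Hf] [w Hg]| | |].
- case: (eqVneq c 0) => [->|c0]; last exact: ex_above (value2_const c0).
  by exists 0; rewrite mpolyC0 rmorph0; apply: above0.
- exists (Num.min u w); rewrite rmorphD.
  by apply: aboveD; [apply: above_le Hf|apply: above_le Hg]; rewrite ge_min lexx ?orbT.
- by exists (u + w); rewrite rmorphM; apply: (aboveM value2EM).
- exact: ex_above value2_x.
- by rewrite -fracP0; apply: ex_above (value2_P 0).
by rewrite -fracQ0; apply: ex_above (value2_Q 0).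
Qed.

Lemma E2_frac (f : K) : exists s t,
  comb iota E2 t != 0 /\ f = comb iota E2 s / comb iota E2 t.
Proof.
have [a [b [b0 ->]]] := fraction_quotient f.
have [_ [s _ Ea]] := mpoly_above a; have [_ [t _ Eb]] := mpoly_above b.
by exists s, t; rewrite -Ea -Eb tofrac_eq0.
Qed.

(** Multiplying a relation by a large power of x turns it into one between standard
    monomials in k[x,y,z]. *)
Lemma E2_independent : independent iota E2.
Proof.
move=> s sum0 i.
pose N := (\max_(p <- i :: [seq p.2 | p <- s]) `|p.1.1|)%N.
have leN p : p \in i :: [seq p.2 | p <- s] -> 0 <= p.1.1 + N%:Z.
  move=> ps; have : (`|p.1.1| <= N)%N.
    by apply: (@leq_bigmax_seq _ _ xpredT (fun p => `|p.1.1|%N)).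
  by lia.
pose shift (p : int * nat * nat) := (`|(p.1.1 + N%:Z)%R|%N, p.1.2, p.2).
pose F (p : nat * nat * nat) := varx k ^+ p.1.1
  * stdmon s1 len1 (polP beta lam) p.1.2 * stdmon s2 len2 (polQ beta gam lam mu) p.2.
have tauF p : p \in i :: [seq p.2 | p <- s] -> tau (F (shift p)) = x ^+ N * E2 p.
  move=> ps; rewrite /F !rmorphM rmorphXn !rmorph_stdmon /=.
  rewrite exprnP gez0_abs ?leN // expfzDr ?x_neq0 // -exprnP.
  by rewrite [x ^ _ * _]mulrC -!mulrA; congr (_ * _); rewrite mulrA.
have := mpoly_independent (lam := lam) (mu := mu) (gam := gam) beta_gt0 ltn_len1 ltn_len2.
move=> /(_ [seq (p.1, shift p.2) | p <- s] _ (shift i)) H.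
rewrite -[RHS]H; last first.
  apply/eqP; rewrite -tofrac_eq0 rmorph_sum big_map big_seq.
  rewrite (eq_bigr (fun p => x ^+ N * (iota p.1 * E2 p.2))) => [|p ps].
    by rewrite -big_seq -mulr_sumr sum0 mulr0.
  rewrite -[LHS]/(tau (p.1%:MP * F (shift p.2))) tofracM tauF; first exact: mulrCA.
  by rewrite inE map_f ?orbT.
rewrite big_map big_seq_cond [RHS]big_seq_cond; apply: eq_bigl => p /=.
case ps: (p \in s) => //=; apply/eqP/eqP => [->//|].
have := leN _ (mem_head i _); have : p.2 \in i :: [seq p.2 | p <- s].
  by rewrite inE map_f ?orbT.
move/leN; case: (p.2) (i) => [[t n] m] [[t' n'] m'] /= le1 le2 [] Et -> ->.
by congr (_, _, _); move: Et; lia.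
Qed.

Lemma E2_indep i : ~ above iota E2 v2 (v2 i) (E2 i).
Proof. exact: (independent_not_above E2_independent). Qed.

Definition is_solution (nu : K -> rat) : Prop :=
  [/\ is_valuation nu, dominates nu (@loc_xyz k),
      forall i : nat, nu (tofrac3 (defP beta lam i)) = beta i &
      forall i : nat, (0 < i)%N -> nu (tofrac3 (defQ beta gam lam mu i)) = gam i].

Lemma solution_exists : exists nu, is_solution nu.
Proof.
pose nu := nu_of iota E2 v2.
have nu_val : is_valuation nu := nu_of_valuation E2_frac v2_inj value2EM E2_indep.
have nu_valueE u f : value2 u f -> nu f = u.
  exact: (nu_of_value E2_frac v2_inj value2EM E2_indep value2_1).
have nuP i : nu (tofrac3 (defP beta lam i)) = beta i.
  by case: i => [|i]; apply: nu_valueE; [exact: value2_x|exact: value2_P].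
have nuQ i : (0 < i)%N -> nu (tofrac3 (defQ beta gam lam mu i)) = gam i.
  by case: i => // i _; apply: nu_valueE; apply: value2_Q.
exists nu; split=> //; apply: nu_dominates => //.
- by move=> c c0; apply/nu_valueE/value2_const.
- by have := nuP 0%N; rewrite /tofrac3 => ->.
- by have := nuP 1%N; rewrite /tofrac3 defP1 => ->.
by have := nuQ 1%N isT; rewrite /tofrac3 defQ1 => ->; apply: gam_gt0.
Qed.

Lemma solution_const nu : is_solution nu -> forall c, c != 0 -> nu (iota c) = 0.
Proof.
move=> [nu_val nu_dom _ _]; apply: (dominates_const nu_val nu_dom) => c.
exact: loc_xyz_mpoly.
Qed.

Lemma solution_E2 nu : is_solution nu -> forall i, nu (E2 i) = v2 i.
Proof.
move=> [nu_val _ nuP nuQ] [[t n] m].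
have P0 j : fracP j != 0 := value_neq0 E2_indep (value2_P j).
have Q0 j : fracQ j != 0 := value_neq0 E2_indep (value2_Q j).
have mon0 J (T : nat -> K) b : (forall j, T j != 0) -> mon J T b != 0.
  by move=> T0; rewrite prodf_seq_neq0; apply/allP => j _ /=; rewrite expf_neq0.
have E00 : E0 t != 0 by rewrite expfz_neq0 ?x_neq0.
rewrite /E2 /v2 /E1 /v1 /towerE /towerv /stdmon /stdlin /=.
rewrite !(valuationM nu_val) ?mulf_neq0 ?mon0 // !(valuation_mon _ _ nu_val) //.
rewrite (valuationXz nu_val) ?x_neq0 // (nuP 0%N); congr (_ + _ + _).
  by apply: eq_bigr => j _; rewrite /= nuP.
by apply: eq_bigr => j _; rewrite /= nuQ.
Qed.

Lemma solution_unique nu nu' : is_solution nu -> is_solution nu' ->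
  forall a, a != 0 -> nu a = nu' a.
Proof.
move=> Hnu Hnu'; have [nu_val _ _ _] := Hnu; have [nu_val' _ _ _] := Hnu'.
apply: (valuation_unique E2_frac v2_inj nu_val nu_val' (solution_const Hnu)
  (solution_const Hnu') _ (solution_E2 Hnu) (solution_E2 Hnu')) => i.
exact: (value_neq0 E2_indep (valueE iota E2 v2 i)).
Qed.

End MonomialBasis.

Theorem theorem5p1 (k : fieldType) (beta gam : nat -> rat) (lam mu : nat -> k)
  (beta_gt0 : forall i : nat, 0 < beta i)
  (gam_gt0 : forall i : nat, (0 < i)%N -> 0 < gam i)
  (beta_lt : forall i : nat, (0 < i)%N -> (q beta i)%:R * beta i < beta i.+1)
  (gam_lt : forall i : nat, (0 < i)%N ->
     (rbar0 beta gam i)%:R * beta 0%N + (sbar beta gam i)%:R * gam i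
       < gam i.+1)
  (lam_neq0 : forall i : nat, (0 < i)%N -> lam i != 0)
  (mu_neq0 : forall i : nat, (0 < i)%N -> mu i != 0)
  (q_inf : forall N : nat, exists i : nat, (N < i)%N /\ (1 < q beta i)%N)
  (sbar_inf : forall N : nat, exists i : nat,
     (N < i)%N /\ (1 < sbar beta gam i)%N) :
  let is_solution (nu : ratfun3 k -> rat) : Prop :=
    [/\ is_valuation nu,
        dominates nu (@loc_xyz k),
        forall i : nat, nu (tofrac3 (defP beta lam i)) = beta i &
        forall i : nat, (0 < i)%N ->
          nu (tofrac3 (defQ beta gam lam mu i)) = gam i] in
  (exists nu : ratfun3 k -> rat, is_solution nu) /\
  (forall nu nu' : ratfun3 k -> rat, is_solution nu -> is_solution nu' ->
     forall a : ratfun3 k, a != 0 -> nu a = nu' a).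
Proof.
have [len1 ltn_len1] : exists len1, forall m, (m < radix (q beta \o succn) (len1 m))%N.
  apply: radix_unbounded => [j|N]; first exact: q_gt0.
  by have [[|i] [lt_i gt1]] := q_inf N => //; exists i.+1.
have [len2 ltn_len2] : exists len2, forall m, (m < radix (sbar beta gam \o succn) (len2 m))%N.
  apply: radix_unbounded => [j|N]; first exact: sbar_gt0.
  by have [[|i] [lt_i gt1]] := sbar_inf N => //; exists i.+1.
split.
  exact: (solution_exists beta_gt0 gam_gt0 beta_lt gam_lt lam_neq0 mu_neq0 ltn_len1 ltn_len2).
exact: (solution_unique beta_gt0 beta_lt gam_lt lam_neq0 mu_neq0 ltn_len1 ltn_len2).
Qed.
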